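(* Suppose $L$ satisfies (1)–(3) of the context. For $\epsilon,h>0$ let $\lambda_{\epsilon,h}\in\mathbb{R}$ and $\mathbb{Z}^N$-periodic Lipschitz functions $\phi_{\epsilon,h},\bar\phi_{\epsilon,h}$ satisfy $\mathcal G[\phi_{\epsilon,h}]=\phi_{\epsilon,h}+\lambda_{\epsilon,h}$ and $\bar{\mathcal G}[\bar\phi_{\epsilon,h}]=\bar\phi_{\epsilon,h}+\lambda_{\epsilon,h}$, with semiconcavity moduli bounded by a constant independent of $\epsilon$ and of $h$ small. Suppose also that $\phi_{\epsilon,h}$ and $\bar\phi_{\epsilon,h}$ are bounded uniformly in $\epsilon,h$ and that $$\int_{\mathbb{T}^N}e^{-\frac{\bar\phi_{\epsilon,h}(x)+\phi_{\epsilon,h}(x)}{\epsilon h}}dx=1.$$ Define $\theta_{\epsilon,h}:\mathbb{T}^N\to\mathbb{R}$ by $\theta_{\epsilon,h}(x)=e^{-\frac{\bar\phi_{\epsilon,h}(x)+\phi_{\epsilon,h}(x)}{\epsilon h}}$. Then the probability density $$\mu_{\epsilon,h}(x,v)=\theta_{\epsilon,h}(x)\,e^{-\frac{hL(x,v)+\phi_{\epsilon,h}(x+hv)-\phi_{\epsilon,h}(x)-\lambda_{\epsilon,h}}{\epsilon h}}$$ minimizes the functional $$\mu\mapsto\int_{\mathbb{T}^N\times\mathbb{R}^N}L(x,v)\,d\mu(x,v)+\epsilon S[\mu]$$ over the densities in $\mathcal M_h$.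
   Context: $\mathbb{T}^N=\mathbb{R}^N/\mathbb{Z}^N$; functions on $\mathbb{T}^N$ are identified with $\mathbb{Z}^N$-periodic functions on $\mathbb{R}^N$. The Lagrangian $L:\mathbb{R}^N\times\mathbb{R}^N\to\mathbb{R}$ is of class $C^2$, $\mathbb{Z}^N$-periodic in $x$, and satisfies: (1) $\lim_{|v|\to\infty}L(x,v)/|v|=+\infty$ uniformly in $x$; (2) the Hessian $\left(\partial^2L/\partial v_i\partial v_j\right)(x,v)$ is positive definite; (3) there are constants $C,\Gamma>0$ with $L(x+y,v-z)+L(x-y,v+z)-2L(x,v)\le C|y|^2+\Gamma|z|^2$ for all $x,y,v,z$. For $\epsilon,h>0$ and continuous $\phi:\mathbb{T}^N\to\mathbb{R}$, $$\mathcal G[\phi](x)=-\epsilon h\ln\int_{\mathbb{R}^N}e^{-\frac{hL(x,v)+\phi(x+hv)}{\epsilon h}}dv,\qquad \bar{\mathcal G}[\phi](x)=-\epsilon h\ln\int_{\mathbb{R}^N}e^{-\frac{hL(x-hv,v)+\phi(x-hv)}{\epsilon h}}dv.$$ $\mathcal M_h$ is the set of Borel probability measures $\mu$ on $\mathbb{T}^N\times\mathbb{R}^N$ with $\int(\varphi(x+hv)-\varphi(x))\,d\mu=0$ for all $\varphi\in C(\mathbb{T}^N)$; ''densities in $\mathcal M_h$'' are those elements having a density $\mu(x,v)$ with respect to Lebesgue measure. The entropy is $$S[\mu]=\int_{\mathbb{T}^N\times\mathbb{R}^N}\mu(x,v)\ln\frac{\mu(x,v)}{\int_{\mathbb{R}^N}\mu(x,w)\,dw}\,dx\,dv.$$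 The semiconcavity modulus of $u$ is bounded by $\sigma$ if $u(x+y)+u(x-y)-2u(x)\le\sigma|y|^2$ for all $x,y$. *)

(* Defs.v *)
From HB Require Import structures.
From mathcomp Require Import all_boot all_order all_algebra.
From mathcomp Require Import all_classical all_reals all_analysis.
From mathcomp Require Import measurable_realfun.

Set Implicit Arguments.
Unset Strict Implicit.
Unset Printing Implicit Defensive.

Import Order.TTheory GRing.Theory Num.Theory.
Import numFieldNormedType.Exports.

Local Open Scope classical_set_scope.
Local Open Scope ring_scope.

Definition rV_display : measure_display.
Proof. exact: default_measure_display. Qed.

(* Row vectors carry the Borel sigma-algebra of their topology. *)
Section borel_rV.
Variables (R : realType) (n : nat).

Let borel : set_system 'rV[R]_n := <<s open >>.

Let borel0 : borel set0.
Proof. exact: sigma_algebra0. Qed.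

Let borelC A : borel A -> borel (~` A).
Proof. exact: sigma_algebraC. Qed.

Let borel_bigcup (F : (set 'rV[R]_n)^nat) :
  (forall i, borel (F i)) -> borel (\bigcup_i F i).
Proof. exact: sigma_algebra_bigcup. Qed.

HB.instance Definition _ :=
  @isMeasurable.Build rV_display 'rV[R]_n borel borel0 borelC borel_bigcup.

End borel_rV.

Section measurable_rV.
Variables (R : realType) (n : nat).

Lemma open_measurable_rV (U : set 'rV[R]_n) : open U -> measurable U.
Proof. exact: sub_sigma_algebra. Qed.

Lemma measurable_coord (i : 'I_n) :
  measurable_fun setT (fun x : 'rV[R]_n => x 0 i).
Proof.
apply: (measurability _ (RGenOpens.measurableE R)) => //.
move=> _ [_ [a [b ->] <-]]; rewrite setTI.
apply: open_measurable_rV; apply: open_comp; last exact: interval_open.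
by move=> x _; exact: coord_continuous.
Qed.

Lemma open_rV_bigcup (U : set 'rV[R]_n) : open U ->
  U = \bigcup_(c in [set c : 'rV[rat]_n * rat |
                     ball (map_mx ratr c.1 : 'rV[R]_n) (ratr c.2) `<=` U])
        ball (map_mx ratr c.1 : 'rV[R]_n) (ratr c.2).
Proof.
move=> oU; apply/seteqP; split => [x Ux|x [c /= cU xc]]; last exact: cU.
have /nbhs_ballP[e /= e0 exU] : nbhs x U by apply: open_nbhs_nbhs.
have /rat_in_itvoo[r] : 0 < e / 2 by rewrite divr_gt0.
rewrite in_itv/= => /andP[r0 re].
have /choice[q qP] : forall i, exists q : rat, ball (x 0 i) (ratr r) (ratr q : R).
  move=> i; have /rat_in_itvoo[q] : x 0 i - ratr r < x 0 i + ratr r.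
    by rewrite ltrD2l gtrN.
  by rewrite in_itv/= => qr; exists q; rewrite /ball/= ltr_distlC.
have xq : ball (map_mx ratr (\row_i q i) : 'rV[R]_n) (ratr r) x.
  by split => // i j; rewrite !mxE ord1; apply/ball_sym/qP.
exists (\row_i q i, r) => //= y ry; apply: exU.
apply: (@le_ball _ _ _ (ratr r + ratr r)); last first.
  exact: ball_triangle (ball_sym xq) ry.
by rewrite (splitr e); apply: lerD; exact: ltW.
Qed.

Lemma measurable_rVP d (T : measurableType d) (f : T -> 'rV[R]_n) :
  (forall i, measurable_fun setT (fun t => f t 0 i)) -> measurable_fun setT f.
Proof.
move=> mf; apply: (@measurability _ _ _ _ setT f open) => // _ [U oU <-].
rewrite setTI (open_rV_bigcup oU) preimage_bigcup bigcup_mkcond.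
apply: countable_bigcupT_measurable; first exact: countableP.
move=> c; case: ifPn => // _.
have [r0|r0] := ltP 0 (ratr c.2 : R); last first.
  rewrite (_ : _ @^-1` _ = set0)//; apply/seteqP; split => // t /= [].
  by rewrite ltNge r0.
rewrite (_ : _ @^-1` _ = \bigcap_(i in [set: 'I_n])
  ((fun t => f t 0 i) @^-1` ball (ratr (c.1 0 i) : R) (ratr c.2))).
  apply: fin_bigcap_measurable => // i _.
  rewrite -[X in measurable X]setTI; apply: mf => //.
  by apply: open_measurable; exact: ball_open.
apply/seteqP; split => t /=.
  by move=> [_ fc] i _; have := fc 0 i; rewrite mxE.
by move=> fc; split => // i j; rewrite mxE ord1; exact: fc.
Qed.

End measurable_rV.

(* N-dimensional Lebesgue measure is the N-fold product of the one-dimensional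
   one, transported along R * 'rV_n -> 'rV_n.+1. *)
Section lebesgue_rV.
Variable R : realType.

Definition rV_cons n (p : R * 'rV[R]_n) : 'rV[R]_n.+1 := row_mx p.1%:M p.2.

Lemma rV_cons0 n (p : R * 'rV[R]_n) : rV_cons p 0 0 = p.1.
Proof.
transitivity (rV_cons p 0 (@lshift 1 n 0)); last first.
  by apply: etrans (row_mxEl _ _ _ _) _; rewrite mxE mulr1n.
by congr (rV_cons p _ _); exact: val_inj.
Qed.

Lemma rV_consS n (p : R * 'rV[R]_n) i : rV_cons p 0 (lift 0 i) = p.2 0 i.
Proof.
transitivity (rV_cons p 0 (@rshift 1 n i)); last first.
  exact: row_mxEr.
by congr (rV_cons p _ _); exact: val_inj.
Qed.

Lemma measurable_rV_cons n : measurable_fun setT (@rV_cons n).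
Proof.
apply: measurable_rVP => i; have [j ->|->] := unliftP 0 i.
  rewrite (_ : (fun _ => _) = (fun x : 'rV[R]_n => x 0 j) \o snd).
    by apply: measurableT_comp => //; exact: measurable_coord.
  by apply/funext => p; rewrite rV_consS.
rewrite (_ : (fun _ => _) = fst); first exact: measurable_fst.
by apply/funext => p; rewrite rV_cons0.
Qed.

Section step.
Variables (n : nat) (mu : {sigma_finite_measure set 'rV[R]_n -> \bar R}).

Definition lebesgue_rV_step : set 'rV[R]_n.+1 -> \bar R :=
  pushforward (@lebesgue_measure R \x mu)%E (@rV_cons n).

Let step0 : lebesgue_rV_step set0 = 0%E.
Proof. by rewrite /lebesgue_rV_step /pushforward preimage_set0 measure0. Qed.

Let step_ge0 A : (0 <= lebesgue_rV_step A)%E.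
Proof. exact: (measure_ge0 (@lebesgue_measure R \x mu)%E). Qed.

Let step_sigma_additive : semi_sigma_additive lebesgue_rV_step.
Proof.
have mpre A : measurable A -> measurable (@rV_cons n @^-1` A).
  by move=> mA; rewrite -[X in measurable X]setTI; exact: measurable_rV_cons.
move=> F mF tF mUF; rewrite /lebesgue_rV_step /pushforward preimage_bigcup.
apply: measure_semi_sigma_additive.
- by move=> k; exact: mpre.
- by move=> i j _ _ [x [Fi Fj]]; apply: tF => //; exists (rV_cons x).
- by rewrite -preimage_bigcup; exact: mpre.
Qed.

HB.instance Definition _ := isMeasure.Build _ _ _ lebesgue_rV_step
  step0 step_ge0 step_sigma_additive.

Let step_sigma_finite : sigma_finite setT lebesgue_rV_step.
Proof.
have /sigma_finiteP[F [FT ndF Foo]] := sigma_finiteT (@lebesgue_measure R).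
have /sigma_finiteP[G [GT ndG Goo]] := sigma_finiteT mu.
pose tail (x : 'rV[R]_n.+1) : R * 'rV[R]_n := (x 0 0, \row_i x 0 (lift 0 i)).
have mtail : measurable_fun setT tail.
  apply: measurable_fun_pair; first exact: measurable_coord.
  apply: measurable_rVP => i.
  rewrite (_ : (fun _ => _) = (fun x : 'rV[R]_n.+1 => x 0 (lift 0 i))).
    exact: measurable_coord.
  by apply/funext => x; rewrite mxE.
have consK p : tail (rV_cons p) = p.
  rewrite /tail rV_cons0 [p in RHS]surjective_pairing; congr pair.
  by apply/rowP => i; rewrite mxE rV_consS.
exists (fun k => tail @^-1` (F k `*` G k)).
  rewrite -preimage_bigcup (_ : \bigcup_k _ = setT) ?preimage_setT//.
  rewrite -setXTT FT GT; apply/seteqP; split => -[x y].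
    by move=> [k _ [/= Fx Gy]]; split; exists k.
  move=> [/= [k _ Fx] [l _ Gy]]; exists (maxn k l) => //; split.
    by move: x Fx; exact/subsetPset/ndF/leq_maxl.
  by move: y Gy; exact/subsetPset/ndG/leq_maxr.
move=> k; have [mF Fk] := Foo k; have [mG Gk] := Goo k; split.
  by rewrite -[X in measurable X]setTI; apply: mtail => //; exact: measurableX.
rewrite /lebesgue_rV_step /pushforward -comp_preimage.
rewrite (_ : tail \o _ = id); last by apply/funext => p /=; rewrite consK.
by rewrite preimage_id product_measure1E// lte_mul_pinfty// ge0_fin_numE.
Qed.

HB.instance Definition _ := Measure_isSigmaFinite.Build _ _ _ lebesgue_rV_step
  step_sigma_finite.

End step.

Fixpoint lebesgue_rV n : {sigma_finite_measure set 'rV[R]_n -> \bar R} :=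
  match n with
  | 0 => dirac (0 : 'rV[R]_0)
  | n'.+1 => lebesgue_rV_step (lebesgue_rV n')
  end.

End lebesgue_rV.

(* Class C^k by iterated directional derivatives. *)
Fixpoint class_C (R : realType) (V : normedModType R) (k : nat) (f : V -> R) :
    Prop :=
  match k with
  | 0 => continuous f
  | k'.+1 => continuous f /\
      forall v, (forall x, derivable f x v) /\ class_C k' ('D_v f)
  end.

(* The library integral is total, with value -oo when the positive and the
   negative parts both have infinite integral; this test excludes that case. *)
Definition integral_defined d (T : measurableType d) (R : realType)
    (mu : {measure set T -> \bar R}) (D : set T) (f : T -> \bar R) : bool :=
  (\int[mu]_(x in D) f^\+ x +? - \int[mu]_(x in D) f^\- x)%E.

(* The torus T^N = R^N / Z^N: functions on it are Z^N-periodic functions on R^N,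
   and measures on T^N (resp. T^N x R^N) are measures on R^N (resp. R^N x R^N)
   carried by the fundamental domain [0, 1)^N (resp. [0, 1)^N x R^N). *)
Section torus.
Variables (R : realType) (N : nat).
Local Notation V := 'rV[R]_N.
Local Notation leb := (@lebesgue_rV R N).
Implicit Types (L : V -> V -> R) (phi theta : V -> R) (f : V * V -> R).

(* Euclidean norm; the library norm on row vectors is the sup norm. *)
Definition enorm (x : V) : R := Num.sqrt (\sum_i x 0 i ^+ 2).

Definition Zperiodic phi : Prop :=
  forall k : 'rV[int]_N, periodic phi (map_mx intr k).

Definition unit_cell : set V := [set x | forall i, 0 <= x 0 i < 1].

Definition phase_cell : set (V * V) := unit_cell `*` setT.

Definition lebesgue2 : {measure set (V * V) -> \bar R} := (leb \x leb)%E.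

Definition semiconcave (sigma : R) phi : Prop :=
  forall x y, phi (x + y) + phi (x - y) - 2 * phi x <= sigma * enorm y ^+ 2.

Definition superlinear L : Prop :=
  forall M, exists K, forall x v, K <= enorm v -> M <= L x v / enorm v.

Definition hessian_v L (x v : V) : 'M[R]_N :=
  \matrix_(i, j) 'D_(delta_mx 0 i) ('D_(delta_mx 0 j) (L x)) v.

Definition positive_definite (A : 'M[R]_N) : Prop :=
  forall z : V, z != 0 -> 0 < (z *m A *m z^T) 0 0.

(* The integrals in [op_G], [op_Gbar] and [marginal] are real-valued ones, with
   value 0 if the extended integral is infinite. For superlinear L and continuous
   periodic phi, the former two are finite and positive; the marginal of a
   probability density is finite almost everywhere. *)
Definition op_G (eps h : R) L phi (x : V) : R :=
  - (eps * h) * ln (\int[leb]_v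
      expR (- ((h * L x v + phi (x + h *: v)) / (eps * h)))).

Definition op_Gbar (eps h : R) L phi (x : V) : R :=
  - (eps * h) * ln (\int[leb]_v
      expR (- ((h * L (x - h *: v) v + phi (x - h *: v)) / (eps * h)))).

Definition holonomic (h : R) : set (probability (V * V)%type R) :=
  [set P : probability (V * V)%type R | P phase_cell = 1%E /\
    forall phi, continuous phi -> Zperiodic phi ->
      (\int[P]_z (phi (z.1 + h *: z.2)%R - phi z.1)%:E = 0)%E].

Definition has_density (P : probability (V * V)%type R) f : Prop :=
  [/\ measurable_fun setT f, forall z, 0 <= f z,
      forall v, Zperiodic (fun x => f (x, v)) &
      forall A, measurable A ->
        P A = (\int[lebesgue2]_(z in A `&` phase_cell) (f z)%:E)%E].

Definition holonomic_density (h : R) : set (V * V -> R) :=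
  [set f | exists2 P, holonomic h P & has_density P f].

Definition action_integrand L f (z : V * V) : \bar R := (L z.1 z.2 * f z)%:E.

Definition marginal f (x : V) : R := \int[leb]_w f (x, w).

(* 0 ln 0 = 0, as ln 0 = 0 and x / 0 = 0. *)
Definition entropy_integrand f (z : V * V) : \bar R :=
  (f z * ln (f z / marginal f z.1))%:E.

Definition action L f : \bar R :=
  (\int[lebesgue2]_(z in phase_cell) action_integrand L f z)%E.

Definition entropy f : \bar R :=
  (\int[lebesgue2]_(z in phase_cell) entropy_integrand f z)%E.

Definition penalized_action (eps : R) L f : \bar R :=
  (action L f + eps%:E * entropy f)%E.

(* The functional makes sense at f: both integrals exist in [-oo, +oo] and their
   sum is not of the form +oo - oo. *)
Definition penalized_action_defined (eps : R) L f : bool :=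
  [&& integral_defined lebesgue2 phase_cell (action_integrand L f),
      integral_defined lebesgue2 phase_cell (entropy_integrand f) &
      (action L f +? eps%:E * entropy f)%E].

Definition minimizes_penalized_action (eps : R) L (A : set (V * V -> R)) f :
    Prop :=
  [/\ A f, penalized_action_defined eps L f &
      forall g, A g -> penalized_action_defined eps L g ->
        (penalized_action eps L f <= penalized_action eps L g)%E].

Definition theta_fun (eps h : R) (phi phibar : V -> R) (x : V) : R :=
  expR (- ((phibar x + phi x) / (eps * h))).

Definition mu_fun (eps h : R) L (lambda : R) (phi phibar : V -> R)
    (z : V * V) : R :=
  theta_fun eps h phi phibar z.1 *
  expR (- ((h * L z.1 z.2 + phi (z.1 + h *: z.2) - phi z.1 - lambda)
           / (eps * h))).

End torus.

(* Main.v *)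
(* Set [k(x, v) = exp (- (h L(x, v) + phi(x + h v) - phi x - lambda) / (eps h))].
   The equation of [phi] says that [k(x, .)] has integral 1, so that
   [mu = theta k] has marginal [theta] in [x]; the equation of [phibar] says
   that the image of [mu] under [x + h v] is [theta] again, so that [mu] is
   holonomic.  Now [L + eps ln k = lambda / h - (phi(x + h v) - phi x) / h], whose
   integral against every holonomic density [g] is [lambda / h].  With [m] the
   marginal of [g], the action plus [eps] times the entropy is thus [lambda / h]
   plus [eps] times the integral of [g ln (g / (m k))], which is at least that of
   [g - m k], i.e. 0, by [ln y <= y - 1]; for [g = mu] it vanishes. *)

Require Import Defs.
From HB Require Import structures.
From mathcomp Require Import all_boot all_order all_algebra.
From mathcomp Require Import all_classical all_reals all_analysis.
From mathcomp Require Import measurable_realfun ring lra.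

Set Implicit Arguments.
Unset Strict Implicit.
Unset Printing Implicit Defensive.

Import Order.TTheory GRing.Theory Num.Theory.
Import numFieldNormedType.Exports.

Local Open Scope classical_set_scope.
Local Open Scope ring_scope.

(** * Integration on row vectors *)

(** The identities of the overview are formal until the integrals are controlled. [op_G] and
    [op_Gbar] use real-valued integrals, which are 0 when the extended integral is infinite, and
    [ln 0 = 0]; the fixed-point equations determine the extended integrals only once these are known
    to be finite and positive. Finiteness comes from a lower bound of [L] by the l1 norm of [v] up
    to a constant, positivity from Lebesgue measure not being null, which the normalization of
    [theta] guarantees. For a competitor [g], the action may be infinite, but only as [+oo], and
    definedness of the functional settles that case. When the action is finite, the entropy is still
    not known to be integrable; it is only compared with an integrable minorant. As the marginal is
    0 where the fibre integral is infinite, that comparison holds only almost everywhere. *)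

Section borel_rV_functions.
Context {R : realType}.

Lemma continuous_measurable_rV n (f : 'rV[R]_n -> R) :
  continuous f -> measurable_fun setT f.
Proof.
move=> /continuousP cf.
apply: (measurability _ (RGenOpens.measurableE R)) => //.
move=> _ [_ [a [b ->] <-]]; rewrite setTI.
by apply: open_measurable_rV; apply: cf; exact: interval_open.
Qed.

Lemma cvg_rV (T : Type) (F : set_system T) (FF : ProperFilter F) n
    (f : T -> 'rV[R]_n) (l : 'rV[R]_n) :
  (forall i, (fun t => f t 0 i) @ F --> l 0 i) -> f @ F --> l.
Proof.
move=> fl; apply/cvg_ballP => e e0.
have : \forall t \near F, forall i, ball (l 0 i) e (f t 0 i).
  by apply: filter_forall => i; move/cvg_ballP: (fl i); exact.
by apply: filterS => t lf; split => // i j; rewrite ord1; exact: lf.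
Qed.

(** Pairs carry the product sigma-algebra, whereas measurability of continuous functions is known
    for the Borel one on row vectors. Concatenation is measurable from the former to the latter,
    coordinate by coordinate, and [f] factors through it. *)
Lemma continuous_measurable_rV2 n m (f : 'rV[R]_n * 'rV[R]_m -> R) :
  continuous f -> measurable_fun setT f.
Proof.
move=> cf; pose g (x : 'rV[R]_(n + m)) := f (lsubmx x, rsubmx x).
rewrite (_ : f = g \o (fun z => row_mx z.1 z.2)); last first.
  by apply/funext => -[x v]; rewrite /g/= row_mxKl row_mxKr.
apply: (@measurableT_comp _ _ _ _ _ _ g).
  apply: continuous_measurable_rV => x.
  have sx : (lsubmx y, rsubmx y) @[y --> x] --> (lsubmx x, rsubmx x).
    apply: (@cvg_pair _ _ _ (nbhs x) (nbhs (lsubmx x)) (nbhs (rsubmx x)));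
      apply: cvg_rV => i; rewrite mxE;
      under eq_fun do rewrite mxE; exact: coord_continuous.
  by apply: cvg_comp sx _; exact: cf.
apply: measurable_rVP => i.
rewrite (_ : (fun _ => _) = fun z : 'rV[R]_n * 'rV[R]_m =>
    match fintype.split i with inl j => z.1 0 j | inr j => z.2 0 j end).
  case: (fintype.split i) => j.
    apply: (measurableT_comp (@measurable_coord R n j)); exact: measurable_fst.
  apply: (measurableT_comp (@measurable_coord R m j)); exact: measurable_snd.
by apply/funext => z; rewrite mxE.
Qed.

Lemma measurable_rVDl n (a : 'rV[R]_n) :
  measurable_fun setT (fun x : 'rV[R]_n => x + a).
Proof.
apply: measurable_rVP => i; under eq_fun do rewrite mxE.
by apply: measurable_funD => //; exact: measurable_coord.
Qed.

Lemma measurable_unit_cell n : measurable (@unit_cell R n).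
Proof.
rewrite (_ : @unit_cell R n = \bigcap_(i in [set: 'I_n])
  ((fun x : 'rV[R]_n => x 0 i) @^-1` `[0, 1[%classic)).
  apply: fin_bigcap_measurable => // i _.
  by rewrite -[X in measurable X]setTI; apply: measurable_coord.
by apply/seteqP; split => [x xc i _|x xc i] /=;
  have := xc i; rewrite /= in_itv/=; exact.
Qed.

Lemma unit_cell_cons n (p : R * 'rV[R]_n) :
  unit_cell (rV_cons p) <-> (0 <= p.1 < 1) /\ unit_cell p.2.
Proof.
split=> [c|[c0 c]].
  split; first by have := c 0; rewrite rV_cons0.
  by move=> i; have := c (lift 0 i); rewrite rV_consS.
by move=> i; have [j ->|->] := unliftP 0 i; rewrite ?rV_consS ?rV_cons0.
Qed.

Lemma rV_consD n (p q : R * 'rV[R]_n) :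
  rV_cons p + rV_cons q = rV_cons (p.1 + q.1, p.2 + q.2).
Proof.
by apply/rowP => i; rewrite mxE; have [j ->|->] := unliftP 0 i;
  rewrite ?rV_consS ?rV_cons0 ?mxE.
Qed.

Lemma rV_cons_surj n (x : 'rV[R]_n.+1) :
  x = rV_cons (x 0 0, \row_i x 0 (lift 0 i)).
Proof.
by apply/rowP => i; have [j ->|->] := unliftP 0 i;
  rewrite ?rV_consS ?rV_cons0 ?mxE.
Qed.

Local Open Scope ereal_scope.

Lemma ge0_integral_rV_cons n (f : 'rV[R]_n.+1 -> \bar R) :
  measurable_fun setT f -> (forall x, 0 <= f x) ->
  \int[lebesgue_rV R n.+1]_x f x =
  \int[lebesgue_measure]_t \int[lebesgue_rV R n]_y f (rV_cons (t, y)).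
Proof.
move=> mf f0.
have mfc : measurable_fun setT (f \o @rV_cons R n).
  by apply: measurableT_comp => //; exact: measurable_rV_cons.
transitivity (\int[(lebesgue_measure \x lebesgue_rV R n)]_p
    (f \o @rV_cons R n) p).
  have := @ge0_integral_pushforward _ _ (measurableTypeR R * 'rV[R]_n)%type _ _
    _ (@measurable_rV_cons R n) (lebesgue_measure \x lebesgue_rV R n) _ _
    measurableT mf (fun x _ => f0 x).
  rewrite preimage_setT => <-; apply: eq_measure_integral; last by [].
  exact: measurable_rV_cons.
exact: (@fubini_tonelli1 _ _ (measurableTypeR R) _ R lebesgue_measure
  (lebesgue_rV R n) (f \o @rV_cons R n) mfc (fun p => f0 _)).
Qed.

(** Lebesgue measure and its image under the translation agree on half-open intervals, hence
    everywhere by uniqueness. *)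
Lemma ge0_integral_shift (f : R -> \bar R) (t : R) D : measurable D ->
  measurable_fun setT f -> (forall x, 0 <= f x) ->
  \int[lebesgue_measure]_(x in D) f x =
  \int[lebesgue_measure]_(x in (fun x => x + t)%R @^-1` D) f (x + t)%R.
Proof.
move=> mD mf f0.
have mt : measurable_fun setT
    (fun x : measurableTypeR R => x + t : measurableTypeR R)%R.
  by apply: measurable_funD => //; exact: measurable_cst.
have := ge0_integral_pushforward mt lebesgue_measure mD
  (measurable_funTS mf) (fun x _ => f0 x).
move=> <-; apply: eq_measure_integral => A mA _.
apply: (@lebesgue_measure_unique _ (pushforward lebesgue_measure _)) => //.
move=> _ [[a b]] _ <-; rewrite /= /pushforward.
rewrite (_ : _ @^-1` _ = `]a - t, b - t]%classic)%R; last first.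
  by apply/seteqP; split => x /=; rewrite !in_itv/= ltrBlDr lerBrDr.
rewrite /= !lebesgue_measure_itv/= !lte_fin ltrD2r; case: ifP => // _.
by rewrite !EFinN !EFinD/= -!EFinD; congr EFin; ring.
Qed.

(** Only the fractional part [s] of [t] matters. Translation by [s] carries [[0, 1 - s[] onto [[s,
    1[], and translation by [s - 1] carries [[1 - s, 1[] onto [[0, s[]: the two pieces of the period
    are exchanged. *)
Lemma ge0_integral_periodic1 (g : R -> \bar R) (t : R) :
  measurable_fun setT g -> (forall x, 0 <= g x) ->
  (forall x (k : int), g (x + k%:~R)%R = g x) ->
  \int[lebesgue_measure]_(x in `[0%R, 1%R[) g (x + t)%R =
  \int[lebesgue_measure]_(x in `[0%R, 1%R[) g x.
Proof.
move=> mg g0 gp; pose s := (t - (Num.floor t)%:~R)%R.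
have /andP[s0 s1] : (0 <= s < 1)%R.
  by have := ge_floor t; have := lt_succ_floor t; rewrite /s intrD; lra.
have gs x : g (x + t)%R = g (x + s)%R.
  by rewrite -[RHS](gp _ (Num.floor t)) -addrA subrK.
under eq_integral do rewrite gs.
have mgs u : measurable_fun setT (fun x : R => g (x + u)%R).
  by apply: measurableT_comp => //; apply: measurable_funD.
have itvU a : (0 <= a <= 1)%R ->
    `[0%R, 1%R[%classic = `[0%R, a[ `|` `[a, 1%R[ :> set R.
  move=> a01; apply/seteqP; split => x /=; rewrite !in_itv/=.
    by have [] := ltP x a; [left|right]; lra.
  by case; lra.
have itv0 a : [disjoint (`[0%R, a[%classic : set R) & `[a, 1%R[%classic].
  by apply/disj_setPS => x /= []; rewrite !in_itv/=; lra.
rewrite {1}(itvU (1 - s)%R) ?(itvU s); [|lra|lra].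
rewrite !ge0_integral_setU//=; try exact: measurable_funTS; last first.
  exact: measurable_funTS (mgs s).
rewrite addeC; congr (_ + _).
  rewrite (@ge0_integral_shift g (s - 1)%R)//.
  rewrite (_ : _ @^-1` _ = `[(1 - s)%R, 1%R[%classic); last first.
    by apply/seteqP; split => x /=; rewrite !in_itv/=; lra.
  by apply: eq_integral => x _; rewrite -(gp (x + (s - 1))%R 1%Z) -addrA subrK.
rewrite (@ge0_integral_shift g s `[s, 1%R[)//.
rewrite (_ : _ @^-1` _ = `[0%R, (1 - s)%R[%classic)//.
by apply/seteqP; split => x /=; rewrite !in_itv/=; lra.
Qed.

(** Induction on the dimension: at a fixed first coordinate the tail is translated by the induction
    hypothesis; the integral [G] over the tail is itself periodic in the first coordinate, which the
    one-dimensional case translates. *)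
Lemma ge0_integral_periodic n (g : 'rV[R]_n -> \bar R) (a : 'rV[R]_n) :
  measurable_fun setT g -> (forall x, 0 <= g x) ->
  (forall x (k : 'rV[int]_n), g (x + map_mx intr k)%R = g x) ->
  \int[lebesgue_rV R n]_(x in @unit_cell R n) g (x + a)%R =
  \int[lebesgue_rV R n]_(x in @unit_cell R n) g x.
Proof.
elim: n g a => [|n IH] g a mg g0 gp.
  have -> : a = 0%R by apply/rowP => -[].
  by apply: eq_integral => x _; rewrite addr0.
(* Integer vectors with prescribed head and tail; a zero head or a zero tail turns the joint
   periodicity of [g] into periodicity in the other variable alone. *)
pose icons (z : int) (k : 'rV[int]_n) : 'rV[int]_n.+1 :=
  \row_i oapp (k 0%R) z (unlift 0%R i).
have iconsE z k : map_mx intr (icons z k) =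
    rV_cons (z%:~R, map_mx intr k) :> 'rV[R]_n.+1.
  by apply/rowP => i; have [j ->|->] := unliftP 0%R i;
    rewrite ?rV_consS ?rV_cons0 !mxE ?liftK ?unlift_none.
have cellE f : measurable_fun setT f -> (forall x, 0 <= f x) ->
  \int[lebesgue_rV R n.+1]_(x in @unit_cell R n.+1) f x =
  \int[lebesgue_measure]_(t in `[0%R, 1%R[)
    \int[lebesgue_rV R n]_(y in @unit_cell R n) f (rV_cons (t, y)).
  move=> mf f0; rewrite integral_mkcond ge0_integral_rV_cons; last 2 first.
  - apply/(measurable_restrictT _ _).1; first exact: measurable_unit_cell.
    exact: measurable_funTS.
  - by move=> x; apply: erestrict_ge0.
  rewrite [RHS]integral_mkcond; apply: eq_integral => t _.
  rewrite patchE; case: ifPn => [|]; rewrite ?inE ?notin_setE /= in_itv/= => t01.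
    rewrite [RHS]integral_mkcond; apply: eq_integral => y _.
    rewrite !patchE; congr (if _ then _ else _).
    by apply/idP/idP; rewrite !inE unit_cell_cons/=; [case|].
  rewrite integral0_eq// => y _; rewrite patchE memNset// unit_cell_cons/=.
  by case.
have mgcons t : measurable_fun setT (fun y => g (rV_cons (t, y))).
  apply: measurableT_comp => //.
  apply: (measurableT_comp (@measurable_rV_cons R n)).
  exact: pair1_measurable.
rewrite cellE//; last first.
  by apply: measurableT_comp => //; exact: measurable_rVDl.
rewrite cellE//.
pose b := \row_i a 0%R (lift 0%R i).
pose G t := \int[lebesgue_rV R n]_(y in @unit_cell R n) g (rV_cons (t, y)).
transitivity (\int[lebesgue_measure]_(t in `[0%R, 1%R[) G (t + a 0%R 0%R)%R).
  apply: eq_integral => t _.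
  rewrite /G -(IH (fun y => g (rV_cons (t + a 0%R 0%R, y))%R) b)//.
    apply: eq_integral => y _.
    by rewrite [in LHS](rV_cons_surj a) rV_consD.
  by move=> x k; rewrite -[RHS](gp _ (icons 0%R k)) iconsE rV_consD/= addr0.
apply: ge0_integral_periodic1.
(* [fubini_F] integrates over a whole fibre, so the restriction to the cell is moved into the
   integrand. *)
- rewrite (_ : G = fubini_F (lebesgue_rV R n)
      (fun p => ((g \o @rV_cons R n) \_ (setT `*` @unit_cell R n)) p)).
    apply: measurable_fun_fubini_tonelli_F.
      apply/(measurable_restrictT _ _).1.
        by apply: measurableX => //; exact: measurable_unit_cell.
      apply: measurable_funTS; apply: measurableT_comp => //.
      exact: measurable_rV_cons.
    by move=> p; apply: erestrict_ge0 => q _; exact: g0.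
  apply/funext => t; rewrite /G integral_mkcond; apply: eq_integral => y _.
  rewrite !patchE; congr (if _ then _ else _).
  by apply/idP/idP; rewrite !inE/= => //; case.
- by move=> t; apply: integral_ge0.
- move=> t k; apply: eq_integral => y _.
  by rewrite -[RHS](gp _ (icons k 0%R)) iconsE rV_consD/= map_mx0 addr0.
Qed.

End borel_rV_functions.

(** * Measures with a density *)

Section density.
Local Open Scope ereal_scope.
Context d (T : measurableType d) (R : realType).
Context (m : {measure set T -> \bar R}) (D : set T) (f : T -> R).
Hypotheses (mD : measurable D) (mf : measurable_fun setT f).
Hypothesis f0 : forall x, (0 <= f x)%R.

Section integral.
Variable P : {measure set T -> \bar R}.
Hypothesis Pf : forall A, measurable A -> P A = \int[m]_(x in A `&` D) (f x)%:E.

Import HBNNSimple.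

Let mEf : measurable_fun D (EFin \o f).
Proof. by apply/measurable_EFinP; exact: measurable_funTS. Qed.

Let ge0_integral_density_nnsfun (g : {nnsfun T >-> R}) :
  \int[P]_x (g x)%:E = \int[m]_(x in D) ((g x)%:E * (f x)%:E).
Proof.
under eq_integral do rewrite fimfunE -fsumEFin//.
rewrite ge0_integral_fsum//; last 2 first.
  - by move=> r /=; apply: measurableT_comp => //; exact: measurableT_comp.
  - by move=> r t _; rewrite EFinM nnfun_muleindic_ge0.
under [RHS]eq_integral => x _.
  rewrite fimfunE -fsumEFin// ge0_mule_fsuml//; last first.
    by move=> r; rewrite EFinM nnfun_muleindic_ge0.
  over.
rewrite ge0_integral_fsum//; last 2 first.
  - move=> r; apply: emeasurable_funM => //.
    apply/measurable_funTS/measurable_EFinP => /=.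
    exact: measurableT_comp.
  - move=> r t _; rewrite mule_ge0 ?lee_fin ?f0//.
    by have := nnfun_muleindic_ge0 g r t; rewrite -EFinM lee_fin.
apply: eq_fsbigr => r /set_mem[x _ <-].
rewrite integralZl_indic_nnsfun//= integral_indic// setIT Pf//.
under [RHS]eq_integral do rewrite EFinM -muleA.
rewrite ge0_integralZl//; last 3 first.
- apply: emeasurable_funM => //; apply/measurable_funTS/measurable_EFinP.
  exact: measurable_indic.
- by move=> t _; rewrite mule_ge0// lee_fin.
- by rewrite lee_fin.
congr (_ * _); rewrite setIC integral_mkcondr; apply: eq_integral => t _.
by rewrite patchE indicE; case: ifPn; rewrite ?mul1e ?mul0e.
Qed.

(** Monotone convergence on both sides, from simple functions, for which the formula is the
    hypothesis [Pf] and linearity. *)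
Lemma ge0_integral_density (g : T -> \bar R) :
  measurable_fun setT g -> (forall x, 0 <= g x) ->
  \int[P]_x g x = \int[m]_(x in D) (g x * (f x)%:E).
Proof.
move=> mg g0; pose g_ := nnsfun_approx measurableT mg.
have g_g x : (g_ n x)%:E @[n --> \oo] --> g x by apply: cvg_nnsfun_approx.
have ndg x : {homo (fun n => g_ n x) : a b / (a <= b)%N >-> (a <= b)%R}.
  by move=> a b ab; exact/lefP/nd_nnsfun_approx.
transitivity (limn (fun n => \int[P]_x (g_ n x)%:E)).
  rewrite -monotone_convergence//.
  - by apply: eq_integral => x _; apply/esym/cvg_lim => //; exact: g_g.
  - by move=> n; exact/measurable_EFinP/measurable_funTS.
  - by move=> n x _; rewrite lee_fin.
  - by move=> x _ a b ab; rewrite lee_fin ndg.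
under eq_fun do rewrite ge0_integral_density_nnsfun.
rewrite -monotone_convergence//.
- apply: eq_integral => x _; apply/cvg_lim => //.
  by apply: cvgeZr => //; exact: g_g.
- move=> n; apply: emeasurable_funM => //.
  exact/measurable_funTS/measurable_EFinP.
- by move=> n x _; rewrite mule_ge0// lee_fin.
- by move=> x _ a b ab; rewrite lee_wpmul2r ?lee_fin// ndg.
Qed.

(** No integrability is required: multiplication by [f >= 0] commutes with taking positive and
    negative parts, so the two integrals are the same difference. *)
Lemma integral_density (g : T -> R) : measurable_fun setT g ->
  \int[P]_x (g x)%:E = \int[m]_(x in D) (g x * f x)%:E.
Proof.
move=> /measurable_EFinP mg; rewrite integralE [RHS]integralE.
have mgp := measurable_funepos mg; have mgn := measurable_funeneg mg.
rewrite !ge0_integral_density//.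
by congr (_ - _); apply: eq_integral => x _;
  rewrite ?funeposE ?funenegE -?EFinN/= -!EFin_max -EFinM maxr_pMl ?f0//;
  rewrite mul0r ?mulNr.
Qed.

End integral.

End density.

Section density_probability.
Local Open Scope ereal_scope.
Context d (T : measurableType d) (R : realType).
Context (m : {measure set T -> \bar R}) (D : set T) (f : T -> R).

Lemma density_probability :
  measurable D -> measurable_fun setT f -> (forall x, 0 <= f x)%R ->
  \int[m]_(x in D) (f x)%:E = 1 ->
  exists P : probability T R,
    forall A, measurable A -> P A = \int[m]_(x in A `&` D) (f x)%:E.
Proof.
move=> mD mf f0 f1; pose nu A := \int[m]_(x in A `&` D) (f x)%:E.
have nu0 : nu set0 = 0 by rewrite /nu set0I integral_set0.
have nu_ge0 A : 0 <= nu A by apply: integral_ge0 => x _; rewrite lee_fin.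
have nu_sigma : semi_sigma_additive nu.
  rewrite (_ : nu = fun A => \int[m]_(x in A) ((EFin \o f) \_ D) x); last first.
    by apply/funext => A; rewrite /nu integral_mkcondr.
  apply: semi_sigma_additive_nng_induced.
    apply/(measurable_restrictT _ mD).1.
    by apply/measurable_EFinP; exact: measurable_funTS.
  by move=> x; apply: erestrict_ge0 => y _; rewrite lee_fin.
have nu1 : nu setT = 1 by rewrite /nu setTI.
pose M := isMeasure.Build _ _ _ nu nu0 nu_ge0 nu_sigma.
pose M1 : {measure set T -> \bar R} := HB.pack nu M.
pose M2 := Measure_isProbability.Build _ _ _ M1 nu1.
by exists (HB.pack_for (probability T R) nu M M2).
Qed.

End density_probability.

(** * Coercive exponents *)

Section exponential_decay.
Context {R : realType}.
Local Open Scope ereal_scope.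

(** By evenness it is enough to integrate over the half-line, where the integrand is [c^-1] times
    the density of the exponential law. *)
Lemma integral_expR_abs_lty (c : R) : (0 < c)%R ->
  \int[lebesgue_measure]_t (expR (- (c * `|t|)))%:E < +oo.
Proof.
move=> c0.
have cf : continuous (fun t : R => expR (- (c * `|t|)))%R.
  move=> t; apply: (@continuous_comp _ _ _ (fun t : R => - (c * `|t|))%R expR);
    last exact: continuous_expR.
  apply: (@continuousN _ R^o); apply: continuousM; first exact: cst_continuous.
  exact: norm_continuous.
rewrite ge0_symfun_integralT//; last first.
  by move=> x /=; rewrite normrN.
have ? : measurable_fun setT (EFin \o (fun t : R => expR (- (c * `|t|)))%R).
  by apply/measurable_EFinP; exact: continuous_measurable_fun.
rewrite lte_mul_pinfty//.
have -> : [set x : R | (0 <= x)%R] = `[0%R, +oo[%classic.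
  by apply/seteqP; split => x /=; rewrite in_itv/= andbT.
apply: (@le_lt_trans _ _ (\int[lebesgue_measure]_(t in `[0%R, +oo[)
    (c^-1%:E * (exponential_pdf c t)%:E))).
  apply: ge0_le_integral => //=.
  - exact: measurable_funTS.
  - apply: measurable_funTS; apply: emeasurable_funM => //.
    by apply/measurable_EFinP; exact: measurable_exponential_pdf.
  - move=> x; rewrite in_itv/= andbT => x0.
    rewrite exponential_pdfE// -EFinM lee_fin mulrA mulVf ?gt_eqF// mul1r.
    by rewrite ger0_norm// mulNr.
rewrite ge0_integralZl//; last 3 first.
- apply: measurable_funTS.
  by apply/measurable_EFinP; exact: measurable_exponential_pdf.
- by move=> x _; rewrite lee_fin exponential_pdf_ge0// ltW.
- by rewrite lee_fin invr_ge0 ltW.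
rewrite lte_mul_pinfty// ?lee_fin ?invr_ge0 ?ltW//.
rewrite (@le_lt_trans _ _ (\int[lebesgue_measure]_t (exponential_pdf c t)%:E))//.
  apply: ge0_subset_integral => //.
    by apply/measurable_EFinP; exact: measurable_exponential_pdf.
  by move=> x _; rewrite lee_fin exponential_pdf_ge0// ltW.
by rewrite integral_exponential_pdf// ltry.
Qed.

(* Additive over coordinates, so that [expR (- c * norm1)] factors in Tonelli's
   theorem. *)
Definition norm1 n (x : 'rV[R]_n) : R := (\sum_i `|x 0 i|)%R.

Lemma continuous_norm1 n : continuous (@norm1 n).
Proof.
apply: (@continuous_big R); first exact: add_continuous.
move=> i _ x.
apply: (@continuous_comp _ _ _ (fun x : 'rV[R]_n => x 0%R i) Num.norm).
  exact: coord_continuous.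
exact: norm_continuous.
Qed.

Lemma measurable_expR_norm1 n (c : R) :
  measurable_fun setT (fun x : 'rV[R]_n => (expR (- (c * norm1 x)))%:E).
Proof.
apply/measurable_EFinP; apply: continuous_measurable_rV => x.
apply: (@continuous_comp _ _ _ (fun x : 'rV[R]_n => - (c * norm1 x))%R expR);
  last exact: continuous_expR.
apply: (@continuousN _ R^o); apply: continuousM; first exact: cst_continuous.
exact: continuous_norm1.
Qed.

Lemma integral_expR_norm1_lty n (c : R) : (0 < c)%R ->
  \int[lebesgue_rV R n]_x (expR (- (c * norm1 x)))%:E < +oo.
Proof.
move=> c0; elim: n => [|n IH].
  rewrite /= integral_dirac//=; last exact: measurable_expR_norm1.
  by rewrite diracT mul1e ltry.
rewrite ge0_integral_rV_cons; last 2 first.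
- exact: measurable_expR_norm1.
- by move=> x; rewrite lee_fin expR_ge0.
have nc t (y : 'rV[R]_n) : norm1 (rV_cons (t, y)) = (`|t| + norm1 y)%R.
  rewrite /norm1 big_ord_recl rV_cons0; congr (_ + _)%R.
  by apply: eq_bigr => i _; rewrite rV_consS.
under eq_integral => t _.
  under eq_integral do rewrite nc mulrDr opprD expRD EFinM.
  rewrite ge0_integralZl//; last exact: measurable_expR_norm1.
  over.
have fin : \int[lebesgue_rV R n]_x (expR (- (c * norm1 x)))%:E \is a fin_num.
  rewrite ge0_fin_numE//; apply: integral_ge0 => x _.
  by rewrite lee_fin expR_ge0.
have mt : measurable_fun setT (fun t : R => (expR (- (c * `|t|)))%:E).
  apply/measurable_EFinP; apply: continuous_measurable_fun => t.
  apply: (@continuous_comp _ _ _ (fun t : R => - (c * `|t|))%R expR);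
    last exact: continuous_expR.
  apply: (@continuousN _ R^o); apply: continuousM; first exact: cst_continuous.
  exact: norm_continuous.
have I0 : 0 <= \int[lebesgue_rV R n]_x (expR (- (c * norm1 x)))%:E.
  by apply: integral_ge0 => x _; rewrite lee_fin expR_ge0.
by rewrite ge0_integralZr//= muleC lte_mul_pinfty// integral_expR_abs_lty.
Qed.

End exponential_decay.

Section coercivity.
Context {R : realType} {N : nat}.
Local Notation V := 'rV[R]_N.

Lemma compact_continuous_bounded (T : topologicalType) (f : T -> R) (A : set T) :
  continuous f -> compact A -> exists M : R, forall x, A x -> `|f x| <= M.
Proof.
move=> cf cA.
have /compact_bounded : compact (f @` A).
  by apply: continuous_compact => //; exact: continuous_subspaceT.
move=> /pinfty_ex_gt0[M _ fM]; exists M => x Ax; apply: fM; exact: imageP.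
Qed.

Lemma rV_box_compact (a b : R) : compact [set x : V | forall i, a <= x 0 i <= b].
Proof.
have := @rV_compact R N (fun=> `[a, b]%classic) (fun=> @segment_compact R a b).
by congr compact; apply/seteqP; split => x /= xab i; have := xab i;
  rewrite /= in_itv.
Qed.

(** Subtracting integer parts brings [x] into the unit cube without changing the value, and the cube
    times the box of the [v] is compact. *)
Lemma periodic_bounded (f : V * V -> R) (r : R) : continuous f ->
  (forall v, Zperiodic (fun x => f (x, v))) ->
  exists M : R, forall x v : V, (forall i, - r <= v 0 i <= r) -> `|f (x, v)| <= M.
Proof.
move=> cf fp.
have [M fM] := compact_continuous_bounded cf
  (compact_setX (@rV_box_compact 0 1) (@rV_box_compact (- r) r)).
exists M => x v vr; pose k : 'rV[int]_N := \row_i - Num.floor (x 0 i).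
rewrite -(fp v k); apply: fM; split => //= i; rewrite !mxE.
by have := ge_floor (x 0 i); have := lt_succ_floor (x 0 i);
  rewrite intrD mulrNz; lra.
Qed.

Lemma periodic_bounded1 (f : V -> R) : continuous f -> Zperiodic f ->
  exists M : R, forall x, `|f x| <= M.
Proof.
move=> cf fp.
have [||M fM] := @periodic_bounded (f \o fst) 0.
- by move=> z; apply: (@continuous_comp _ _ _ fst f); [exact: cvg_fst|exact: cf].
- by move=> v.
by exists M => x; apply: (fM x 0) => i; rewrite mxE oppr0 lexx.
Qed.

Lemma normr_coord_enorm (v : V) i : `|v 0 i| <= enorm v.
Proof.
rewrite -sqrtr_sqr ler_wsqrtr// (bigD1 i)//= lerDl.
by apply: sumr_ge0 => j _; exact: sqr_ge0.
Qed.

Lemma norm1_le_enorm (v : V) : norm1 v <= N%:R * enorm v.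
Proof.
have -> : N%:R * enorm v = \sum_(i < N) enorm v.
  by rewrite sumr_const card_ord mulr_natl.
by apply: ler_sum => i _; exact: normr_coord_enorm.
Qed.

(** For large [v], superlinearity with slope [a * N] is enough because [norm1 v <= N * enorm v]; the
    remaining [v] lie in a box, where periodicity and compactness bound [L]. *)
Lemma superlinear_ge_norm1 (L : V -> V -> R) (a : R) : 0 < a ->
  continuous (fun z : V * V => L z.1 z.2) -> (forall v, Zperiodic (L ^~ v)) ->
  superlinear L -> exists b, forall x v, a * norm1 v - b <= L x v.
Proof.
move=> a0 cL pL /(_ (a * N%:R))[K LK].
(* The 1 keeps [enorm v] positive outside the box, so that the quotient in [superlinear] is a
   genuine one. *)
pose r := Num.max K 1.
have [M LM] := @periodic_bounded (fun z => L z.1 z.2) r cL pL.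
exists (a * (N%:R * r) + M) => x v.
have [/forallP vr|/forallPn[i]] := boolP [forall i, `|v 0 i| <= r].
  have := LM x v (fun i => ltac:(by rewrite -ler_norml)).
  rewrite ler_norml => /andP[+ _] /=.
  have : a * norm1 v <= a * (N%:R * r).
    rewrite ler_wpM2l ?(ltW a0)//.
    have -> : N%:R * r = \sum_(i < N) r by rewrite sumr_const card_ord mulr_natl.
    by apply: ler_sum => i _; exact: vr.
  lra.
rewrite -ltNge => ri; have re := lt_le_trans ri (normr_coord_enorm v i).
have r1 : 1 <= r by rewrite le_max lexx orbT.
have e0 : 0 < enorm v by lra.
have := LK x v (le_trans (ltac:(by rewrite le_max lexx) : K <= r) (ltW re)).
rewrite ler_pdivlMr// -mulrA => LN.
have : a * norm1 v <= a * (N%:R * enorm v).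
  by rewrite ler_wpM2l ?norm1_le_enorm ?(ltW a0).
have M0 : 0 <= M.
  by apply: le_trans (LM x 0 _) => // j; rewrite mxE oppr_le0 (le_trans ler01 r1).
have : 0 <= a * (N%:R * r) by rewrite !mulr_ge0 ?(ltW a0)// (le_trans ler01 r1).
lra.
Qed.

(** Finiteness is domination by [expR b * expR (- (a * norm1 v))]. If the integral were 0, a
    positive function would vanish almost everywhere and the whole space would be null. *)
Lemma expR_coercive_integral (F : V -> R) (a b : R) :
  lebesgue_rV R N setT != 0%E -> 0 < a -> continuous F ->
  (forall v, a * norm1 v - b <= F v) ->
  exists2 I : R, 0 < I & (\int[lebesgue_rV R N]_v (expR (- F v))%:E = I%:E)%E.
Proof.
move=> leb0 a0 cF Fab.
have mF : measurable_fun setT (fun v => (expR (- F v))%:E).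
  apply/measurable_EFinP; apply: continuous_measurable_rV => v.
  apply: (@continuous_comp _ _ _ (fun x => - F x) expR);
    last exact: continuous_expR.
  by apply: (@continuousN _ R^o); exact: cF.
set I := (\int[_]_v _)%E.
have I0 : (0 <= I)%E by apply: integral_ge0 => v _; rewrite lee_fin expR_ge0.
have Ioo : (I < +oo)%E.
  apply: (@le_lt_trans _ _ (\int[lebesgue_rV R N]_v
      ((expR b)%:E * (expR (- (a * norm1 v)))%:E))%E).
    apply: ge0_le_integral => //=.
    - apply: emeasurable_funM => //; exact: measurable_expR_norm1.
    - move=> v _; rewrite -EFinM -expRD lee_fin ler_expR.
      by have := Fab v; lra.
  rewrite ge0_integralZl//=; last exact: measurable_expR_norm1.
  by rewrite lte_mul_pinfty ?lee_fin ?expR_ge0// integral_expR_norm1_lty.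
exists (fine I); last by rewrite fineK// ge0_fin_numE.
rewrite fine_gt0// Ioo andbT lt_neqAle I0 andbT eq_sym.
apply: contra leb0 => /eqP IE; apply/eqP.
have /(ae_eq_integral_abs _ measurableT mF) :
    (\int[lebesgue_rV R N]_v `|(expR (- F v))%:E| = 0)%E.
  rewrite -[RHS]IE; apply: eq_integral => v _.
  by rewrite gee0_abs ?lee_fin ?expR_ge0.
move=> [A [mA A0 sA]]; rewrite (_ : setT = A)//.
apply/seteqP; split => // v _; apply: sA => /= /(_ Logic.I)[] /eqP.
by rewrite gt_eqF ?expR_gt0.
Qed.

End coercivity.

(** * Gibbs kernel and optimality *)

Section phase_cell.
Context {R : realType} {N : nat}.
Local Notation V := 'rV[R]_N.
Local Notation leb := (@lebesgue_rV R N).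

Lemma measurable_phase_cell : measurable (@phase_cell R N).
Proof. by apply: measurableX => //; exact: measurable_unit_cell. Qed.

Local Open Scope ereal_scope.
Implicit Type f : V * V -> \bar R.

Let restrict_phase_cell f : measurable_fun setT f -> (forall z, 0 <= f z) ->
  measurable_fun setT (f \_ (@phase_cell R N)) /\
  forall z, 0 <= (f \_ (@phase_cell R N)) z.
Proof.
move=> mf f0; split; last by move=> z; apply: erestrict_ge0 => ? _; exact: f0.
apply: (measurable_restrictT f measurable_phase_cell).1.
exact: measurable_funTS.
Qed.

Lemma ge0_integral_phase_cell f : measurable_fun setT f -> (forall z, 0 <= f z) ->
  \int[@lebesgue2 R N]_(z in @phase_cell R N) f z =
  \int[leb]_(x in @unit_cell R N) \int[leb]_v f (x, v).
Proof.
move=> mf f0; have [mr r0] := restrict_phase_cell mf f0.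
rewrite /lebesgue2 integral_mkcond/= (fubini_tonelli1 _ mr r0).
rewrite [RHS]integral_mkcond; apply: eq_integral => x _.
rewrite /fubini_F patchE; case: ifPn => [|]; rewrite ?inE ?notin_setE => xc.
  by apply: eq_integral => v _; rewrite patchE mem_set.
by rewrite integral0_eq// => v _; rewrite patchE memNset// => -[].
Qed.

(** With [v] outside, the inner integral runs over one period at fixed [v], where [x] may be
    translated by a multiple of [v]. *)
Lemma ge0_integral_phase_cell_swap f :
  measurable_fun setT f -> (forall z, 0 <= f z) ->
  \int[@lebesgue2 R N]_(z in @phase_cell R N) f z =
  \int[leb]_v \int[leb]_(x in @unit_cell R N) f (x, v).
Proof.
move=> mf f0; have [mr r0] := restrict_phase_cell mf f0.
rewrite /lebesgue2 integral_mkcond/= (fubini_tonelli1 _ mr r0).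
rewrite [LHS](fubini_tonelli _ mr r0).
apply: eq_integral => v _; rewrite [RHS]integral_mkcond.
apply: eq_integral => x _.
rewrite !patchE; congr (if _ then _ else _).
by apply/idP/idP; rewrite !inE => //; case.
Qed.

Lemma measurable_integral_snd f : measurable_fun setT f -> (forall z, 0 <= f z) ->
  measurable_fun setT (fun x => \int[leb]_v f (x, v)).
Proof. by move=> mf f0; exact: measurable_fun_fubini_tonelli_F. Qed.

End phase_cell.

Section continuity.
Context {R : realType} {N : nat}.
Local Notation V := 'rV[R]_N.

Lemma continuous_shear (a : R) : continuous (fun z : V * V => z.1 + a *: z.2).
Proof.
move=> z; apply: cvgD; first exact: cvg_fst.
by apply: cvgZr; exact: cvg_snd.
Qed.

Lemma continuous_expR_comp (T : topologicalType) (F : T -> R) :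
  continuous F -> continuous (fun x => expR (- F x)).
Proof.
move=> cF x.
apply: (@continuous_comp _ _ _ (fun x => - F x) expR);
  last exact: continuous_expR.
by apply: (@continuousN _ R^o); exact: cF.
Qed.

Lemma continuous_pairr (f : V * V -> R) (x : V) :
  continuous f -> continuous (fun v : V => f (x, v)).
Proof.
move=> cf v; apply: (cvg_comp (fun v : V => (x, v)) f); last exact: cf.
by apply: (@cvg_pair _ _ _ (nbhs v) (nbhs x) (nbhs v)); [exact: cvg_cst|].
Qed.

Lemma continuous_shear_pair (a : R) (f : V * V -> R) (x : V) :
  continuous f -> continuous (fun v : V => f (x + a *: v, v)).
Proof.
move=> cf v; apply: (cvg_comp (fun v : V => (x + a *: v, v)) f); last exact: cf.
apply: (@cvg_pair _ _ _ (nbhs v) (nbhs (x + a *: v)) (nbhs v)) => //.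
by apply: cvgD; [exact: cvg_cst|apply: cvgZr].
Qed.

End continuity.

(** The bound [ln y <= y - 1] at [y = m * k / t], multiplied by [t]. The last hypothesis deals with
    [m = 0]: there [t / m = 0] and [ln 0 = 0], so the right side is 0 whatever [t] is. *)
Lemma gibbs_inequality (R : realType) (t m k : R) :
  0 <= t -> 0 <= m -> 0 < k -> (m = 0 -> t = 0) ->
  t - m * k + t * ln k <= t * ln (t / m).
Proof.
move=> t0 m0 k0 mt; have [->|tn0] := eqVneq t 0.
  by rewrite !mul0r sub0r addr0 oppr_le0 mulr_ge0// ltW.
have tp : 0 < t by rewrite lt_neqAle eq_sym tn0.
have mp : 0 < m.
  by rewrite lt_neqAle eq_sym m0 andbT; apply: contra tn0 => /eqP/mt ->.
have q0 : 0 < m * k / t by rewrite divr_gt0 ?mulr_gt0.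
have lnq : ln (m * k / t) <= m * k / t - 1.
  by have := le_ln1Dx (x := m * k / t - 1); rewrite subrKC; apply; lra.
have -> : ln (t / m) = ln k - ln (m * k / t).
  by rewrite !ln_div ?posrE ?mulr_gt0// lnM ?posrE//; ring.
have -> : t - m * k = t * (1 - m * k / t) by field.
by rewrite -mulrDr ler_pM2l//; lra.
Qed.

(** * The fixed-point equations as identities between extended integrals *)

Section gibbs_minimizer.
Context {R : realType} {N : nat}.
Local Notation V := 'rV[R]_N.
Local Notation leb := (@lebesgue_rV R N).
Local Notation leb2 := (@lebesgue2 R N).
Local Notation D := (@phase_cell R N).
Variables (L : V -> V -> R) (eps h lambda : R) (phi phibar : V -> R).
Hypotheses (eps0 : 0 < eps) (h0 : 0 < h).
Hypothesis cL : continuous (fun z : V * V => L z.1 z.2).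
Hypothesis pL : forall v, Zperiodic (L ^~ v).
Hypothesis sL : superlinear L.
Hypotheses (cphi : continuous phi) (cphibar : continuous phibar).
Hypotheses (pphi : Zperiodic phi) (pphibar : Zperiodic phibar).
Hypothesis phiE : forall x, op_G eps h L phi x = phi x + lambda.
Hypothesis phibarE : forall x, op_Gbar eps h L phibar x = phibar x + lambda.
Hypothesis theta1 : (\int[leb]_(x in @unit_cell R N)
  (theta_fun eps h phi phibar x)%:E = 1)%E.

Local Notation theta := (theta_fun eps h phi phibar).
Local Notation mu := (mu_fun eps h L lambda phi phibar).

Definition gibbs_kernel (z : V * V) : R :=
  expR (- ((h * L z.1 z.2 + phi (z.1 + h *: z.2) - phi z.1 - lambda)
           / (eps * h))).

Local Notation k := gibbs_kernel.

Let eh0 : 0 < eps * h. Proof. exact: mulr_gt0. Qed.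

Lemma continuous_gibbs_kernel : continuous k.
Proof.
apply: continuous_expR_comp => z; apply: cvgM; last exact: cvg_cst.
apply: cvgB; last exact: cvg_cst.
apply: cvgB; last first.
  by apply: (@continuous_comp _ _ _ fst phi); [exact: cvg_fst|exact: cphi].
apply: cvgD; first by apply: cvgM; [exact: cvg_cst|exact: cL].
apply: (@continuous_comp _ _ _ (fun z : V * V => z.1 + h *: z.2) phi).
  exact: continuous_shear.
exact: cphi.
Qed.

Lemma continuous_theta : continuous theta.
Proof.
apply: (@continuous_expR_comp R V (fun x => (phibar x + phi x) / (eps * h))).
move=> x.
apply: (@continuousM _ _ (fun x => phibar x + phi x) (fun=> (eps * h)^-1)).
  by apply: continuousD; [exact: cphibar|exact: cphi].
exact: cst_continuous.
Qed.

Lemma measurable_theta : measurable_fun setT (EFin \o theta).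
Proof.
by apply/measurable_EFinP; apply: continuous_measurable_rV continuous_theta.
Qed.

(** Otherwise the integral of [theta] over the cell would be 0 instead of 1. *)
Lemma lebesgue_rV_setT_neq0 : leb setT != 0%E.
Proof.
apply/eqP => leb0; have : leb (@unit_cell R N) = 0%E.
  apply: (subset_measure0 _ _ _ leb0) => //; exact: measurable_unit_cell.
move=> cell0; move: theta1; rewrite null_set_integral//.
- by move=> /eqP; rewrite eqe eq_sym oner_eq0.
- exact: measurable_unit_cell.
- exact: measurable_funTS measurable_theta.
Qed.

Lemma continuous_op_G_exponent x :
  continuous (fun v : V => (h * L x v + phi (x + h *: v)) / (eps * h)).
Proof.
pose f (z : V * V) := (h * L z.1 z.2 + phi (z.1 + h *: z.2)) / (eps * h).
apply: (@continuous_pairr _ _ f) => z; apply: cvgM; last exact: cvg_cst.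
apply: cvgD.
  by apply: cvgM; [exact: cvg_cst|exact: cL].
apply: (@continuous_comp _ _ _ (fun z : V * V => z.1 + h *: z.2) phi).
  exact: continuous_shear.
exact: cphi.
Qed.

Lemma continuous_op_Gbar_exponent x : continuous
  (fun v : V => (h * L (x - h *: v) v + phibar (x - h *: v)) / (eps * h)).
Proof.
pose f (z : V * V) := (h * L z.1 z.2 + phibar z.1) / (eps * h).
under eq_fun do rewrite -scaleNr.
apply: (@continuous_shear_pair _ _ (- h) f x) => z.
apply: cvgM; last exact: cvg_cst.
apply: cvgD.
  by apply: cvgM; [exact: cvg_cst|exact: cL].
by apply: (@continuous_comp _ _ _ fst phibar); [exact: cvg_fst|exact: cphibar].
Qed.

(** The bound [L >= norm1 - b], multiplied by [h] and divided by [eps * h], gives the slope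
    [eps^-1]. The base points [x v] and [y v] are arbitrary because the bounds on [L] and [psi] are
    uniform in position; this covers both operators. *)
Let coercive_exponent (psi : V -> R) (x y : V -> V) :
  (exists M : R, forall x, `|psi x| <= M) ->
  exists b, forall v,
    eps^-1 * norm1 v - b <= (h * L (x v) v + psi (y v)) / (eps * h).
Proof.
move=> [M psiM]; have [b Lb] := superlinear_ge_norm1 ltr01 cL pL sL.
exists ((h * b + M) / (eps * h)) => v.
rewrite (_ : eps^-1 * norm1 v = h * norm1 v / (eps * h)); last first.
  by field; rewrite !gt_eqF.
rewrite -mulrBl ler_pM2r ?invr_gt0//.
have /andP[psiv _] : - M <= psi (y v) <= M by rewrite -ler_norml.
have hL : h * (norm1 v - b) <= h * L (x v) v.
  by rewrite ler_pM2l// -[norm1 v]mul1r.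
rewrite mulrBr in hL.
lra.
Qed.

(** Inverts the logarithm: coercivity makes the integral a positive real, so that neither default
    value, of [ln] or of the real-valued integral, can intervene. *)
Let log_integral (F : V -> R) (y : R) (b : R) : continuous F ->
  (forall v, eps^-1 * norm1 v - b <= F v) ->
  - (eps * h) * ln (\int[leb]_v expR (- F v)) = y ->
  (\int[leb]_v (expR (- F v))%:E = (expR (- (y / (eps * h))))%:E)%E.
Proof.
move=> cF Fb; rewrite /Rintegral.
have [|I I0 ->] := expR_coercive_integral lebesgue_rV_setT_neq0 _ cF Fb.
  by rewrite invr_gt0.
move=> /= <-; congr EFin; rewrite -{1}(lnK I0); congr expR; field.
by rewrite !gt_eqF.
Qed.

Lemma integral_gibbs_kernel x : (\int[leb]_v (k (x, v))%:E = 1)%E.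
Proof.
have [b Fb] := coercive_exponent (fun=> x) (fun v : V => x + h *: v)
  (periodic_bounded1 cphi pphi).
have IE := log_integral (@continuous_op_G_exponent x) Fb (phiE x).
under eq_integral => v _.
  rewrite (_ : k (x, v) = expR ((phi x + lambda) / (eps * h)) *
      expR (- ((h * L x v + phi (x + h *: v)) / (eps * h)))); last first.
    by rewrite -expRD; congr expR; rewrite /=; field; rewrite !gt_eqF.
  rewrite EFinM; over.
rewrite ge0_integralZl//=; last first.
  apply/measurable_EFinP; apply: continuous_measurable_rV.
  exact/continuous_expR_comp/continuous_op_G_exponent.
by rewrite IE -EFinM -expRD subrr expR0.
Qed.

(** At the base point [x - h *: v] the two occurrences of [phi (x - h *: v)], in [theta] and in the
    kernel, cancel. What is left is the integrand of [op_Gbar] times a factor depending on [x]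
    only. *)
Lemma integral_mu_shear x :
  (\int[leb]_v (mu (x - h *: v, v))%:E = (theta x)%:E)%E.
Proof.
have [b Fb] := coercive_exponent
  (fun v : V => x - h *: v) (fun v : V => x - h *: v)
  (periodic_bounded1 cphibar pphibar).
have IE := log_integral (@continuous_op_Gbar_exponent x) Fb (phibarE x).
under eq_integral => v _.
  rewrite (_ : mu (x - h *: v, v) = expR (- ((phi x - lambda) / (eps * h))) *
      expR (- ((h * L (x - h *: v) v + phibar (x - h *: v)) / (eps * h))));
    last first.
    rewrite /mu_fun /theta_fun/= subrK -!expRD; congr expR; field.
    by rewrite !gt_eqF.
  rewrite EFinM; over.
rewrite ge0_integralZl//=; last first.
  apply/measurable_EFinP; apply: continuous_measurable_rV.
  exact/continuous_expR_comp/continuous_op_Gbar_exponent.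
rewrite IE -EFinM -expRD /theta_fun; congr (expR _)%:E; field.
by rewrite !gt_eqF.
Qed.


(** * Holonomy of the Gibbs density *)

Section holonomic.
Let mk : measurable_fun setT k.
Proof. by apply: continuous_measurable_rV2; exact: continuous_gibbs_kernel. Qed.

Lemma measurable_mu : measurable_fun setT mu.
Proof.
have mtheta : measurable_fun setT theta.
  by apply: continuous_measurable_rV; exact: continuous_theta.
apply: (measurable_funM (f := fun z : V * V => theta z.1)) => //.
exact: measurableT_comp.
Qed.

Lemma mu_ge0 z : 0 <= mu z.
Proof. by rewrite mulr_ge0 ?expR_ge0. Qed.

Lemma mu_Zperiodic v : Zperiodic (fun x => mu (x, v)).
Proof.
move=> n x; rewrite /mu_fun /theta_fun/= pL pphi pphibar.
by rewrite [_ + _ + h *: v]addrAC pphi.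
Qed.

Local Open Scope ereal_scope.

Lemma integral_mu_fst (psi : V -> R) :
  measurable_fun setT psi -> (forall x, 0 <= psi x)%R ->
  \int[leb2]_(z in D) (psi z.1 * mu z)%:E =
  \int[leb]_(x in @unit_cell R N) (psi x * theta x)%:E.
Proof.
move=> mpsi psi0; rewrite ge0_integral_phase_cell; last 2 first.
- apply/measurable_EFinP; apply: measurable_funM; last exact: measurable_mu.
  exact: measurableT_comp.
- by move=> z; rewrite lee_fin mulr_ge0 ?mu_ge0.
apply: eq_integral => x _.
under eq_integral => v _.
  rewrite (_ : (_ * _)%R = psi x * theta x * k (x, v))%R; last first.
    by rewrite -mulrA.
  rewrite EFinM; over.
rewrite ge0_integralZl//=; last 3 first.
- by apply/measurable_EFinP; exact: (measurableT_comp mk (pair1_measurable x)).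
- by move=> v _; rewrite lee_fin expR_ge0.
- by rewrite lee_fin mulr_ge0 ?expR_ge0.
by rewrite integral_gibbs_kernel// mule1.
Qed.

(* Substitute [x - h *: v] for [x] by periodicity, then integrate in [v] by the
   fixed-point equation of [phibar]. *)
Lemma integral_mu_shift (psi : V -> R) :
  continuous psi -> Zperiodic psi -> (forall x, 0 <= psi x)%R ->
  \int[leb2]_(z in D) (psi (z.1 + h *: z.2)%R * mu z)%:E =
  \int[leb]_(x in @unit_cell R N) (psi x * theta x)%:E.
Proof.
move=> cpsi ppsi psi0.
have mshear a : measurable_fun setT (fun z : V * V => psi (z.1 + a *: z.2)%R).
  apply: continuous_measurable_rV2 => z.
  apply: (@continuous_comp _ _ _ (fun z : V * V => z.1 + a *: z.2)%R psi).
    exact: continuous_shear.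
  exact: cpsi.
rewrite ge0_integral_phase_cell_swap; last 2 first.
- apply/measurable_EFinP; apply: measurable_funM; last exact: measurable_mu.
  exact: mshear.
- by move=> z; rewrite lee_fin mulr_ge0 ?mu_ge0.
have cshift : continuous (fun z : V * V => z.1 - h *: z.2)%R.
  by under eq_fun do rewrite -scaleNr; exact: continuous_shear.
pose f (z : V * V) : \bar R := (psi z.1 * mu (z.1 - h *: z.2, z.2)%R)%:E.
have mf : measurable_fun setT f.
  apply/measurable_EFinP; apply: measurable_funM.
    by apply: measurableT_comp => //; exact: continuous_measurable_rV.
  apply: (measurableT_comp measurable_mu).
  apply: measurable_fun_pair => //.
  apply: measurable_rVP => i.
  apply: continuous_measurable_rV2 => z.
  apply: (@continuous_comp _ _ _ (fun z : V * V => z.1 - h *: z.2)%R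
    (fun x : V => x 0%R i)); last exact: coord_continuous.
  exact: cshift.
have f0 z : 0 <= f z by rewrite lee_fin mulr_ge0 ?mu_ge0.
transitivity (\int[leb2]_(z in D) f z).
  rewrite [RHS](ge0_integral_phase_cell_swap mf f0).
  apply: eq_integral => v _.
  pose g (x : V) : \bar R := (psi (x + h *: v)%R * mu (x, v))%:E.
  rewrite -(@ge0_integral_periodic _ _ g (- (h *: v))%R).
  - by apply: eq_integral => x _; rewrite /g subrK.
  - apply/measurable_EFinP; apply: measurable_funM.
      exact: (measurableT_comp (mshear h) (pair2_measurable v)).
    exact: (measurableT_comp measurable_mu (pair2_measurable v)).
  - by move=> x; rewrite lee_fin mulr_ge0 ?mu_ge0.
  - by move=> x n; rewrite /g addrAC ppsi mu_Zperiodic.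
rewrite [LHS](ge0_integral_phase_cell mf f0); apply: eq_integral => x _.
rewrite /f/=; under eq_integral do rewrite EFinM.
rewrite ge0_integralZl//=; last 3 first.
- have : measurable_fun setT (fun v : V => (mu (x - h *: v, v)%R)%R).
    apply: (measurableT_comp measurable_mu).
    apply: measurable_fun_pair => //.
    apply: measurable_rVP => i.
    under eq_fun do rewrite !mxE.
    apply: measurable_funB => //; apply: measurable_funM => //.
    exact: measurable_coord.
  by move/measurable_EFinP.
- by move=> v _; rewrite lee_fin mu_ge0.
- by rewrite lee_fin.
by rewrite integral_mu_shear.
Qed.

Lemma integral_mu : \int[leb2]_(z in D) (mu z)%:E = 1.
Proof.
transitivity (\int[leb2]_(z in D) (cst 1%R z.1 * mu z)%:E).
  by apply: eq_integral => z _; rewrite mul1r.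
rewrite integral_mu_fst// -theta1.
by apply: eq_integral => x _; rewrite mul1r.
Qed.

Lemma mu_holonomic_density : holonomic_density h mu.
Proof.
have [P PE] := density_probability measurable_phase_cell measurable_mu mu_ge0
  integral_mu.
exists P; last first.
  by split => //; [exact: measurable_mu|exact: mu_ge0|exact: mu_Zperiodic].
split.
  by rewrite PE ?setIid ?integral_mu//; exact: measurable_phase_cell.
move=> psi cpsi ppsi; have [M psiM] := periodic_bounded1 cpsi ppsi.
(* The constant cancels in the difference and makes the test function nonnegative, as the
   Tonelli-based formulas for [mu] require. *)
pose psi1 x := (psi x + M)%R.
have psi10 x : (0 <= psi1 x)%R.
  by rewrite -lerBlDr sub0r; have := psiM x; rewrite ler_norml => /andP[].
have psi1M x : (`|psi1 x| <= M + M)%R.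
  rewrite (le_trans (ler_normD _ _))// lerD// ger0_norm//.
  exact: le_trans (psiM 0%R).
have cpsi1 : continuous psi1.
  by move=> x; apply: continuousD; [exact: cpsi|exact: cst_continuous].
have ppsi1 : Zperiodic psi1 by move=> n x; rewrite /psi1 ppsi.
have mpsi1 : measurable_fun setT psi1 by exact: continuous_measurable_rV.
have mshear : measurable_fun setT (fun z : V * V => psi1 (z.1 + h *: z.2)%R).
  apply: continuous_measurable_rV2 => z.
  apply: (@continuous_comp _ _ _ (fun z : V * V => z.1 + h *: z.2)%R psi1).
    exact: continuous_shear.
  exact: cpsi1.
have mfst : measurable_fun setT (fun z : V * V => psi1 z.1).
  exact: measurableT_comp.
have Pint (f : V * V -> R) : measurable_fun setT f ->
    (forall z, `|f z| <= M + M)%R -> P.-integrable setT (EFin \o f).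
  move=> mf fM; apply: measurable_bounded_integrable => //.
    by rewrite -ge0_fin_numE// fin_num_measure.
  exists (M + M)%R; split; first exact: num_real.
  by move=> r rM z _ /=; rewrite (le_trans (fM z))// ltW.
under eq_integral => z _.
  rewrite (_ : (_ - _)%R = psi1 (z.1 + h *: z.2) - psi1 z.1)%R; last first.
    by rewrite /psi1; ring.
  over.
rewrite integralB_EFin//; [|exact: Pint|exact: Pint].
rewrite (integral_density measurable_phase_cell measurable_mu mu_ge0 PE)//.
rewrite (integral_density measurable_phase_cell measurable_mu mu_ge0 PE)//.
rewrite integral_mu_shift// integral_mu_fst// subee//.
rewrite -integral_mu_fst//.
rewrite -(integral_density measurable_phase_cell measurable_mu mu_ge0 PE)//.
by apply: integrable_fin_num => //; exact: Pint.
Qed.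

End holonomic.

(** * Lower bound of the functional and its value at the Gibbs density *)

Section optimality.
(* Chosen so that [L + eps * ln gibbs_kernel = - tilt], whose integral against
   holonomic densities is constant. *)
Definition tilt (z : V * V) : R := (phi (z.1 + h *: z.2) - phi z.1 - lambda) / h.

Let mD : measurable D. Proof. exact: measurable_phase_cell. Qed.

Lemma ln_gibbs_kernel z : ln (k z) = - eps^-1 * (L z.1 z.2 + tilt z).
Proof. by rewrite /gibbs_kernel expRK /tilt; field; rewrite !gt_eqF. Qed.

Let cphi_shear : continuous (fun z : V * V => phi (z.1 + h *: z.2)).
Proof.
move=> z; apply: (@continuous_comp _ _ _ (fun z : V * V => z.1 + h *: z.2) phi).
  exact: continuous_shear.
exact: cphi.
Qed.

Let cphi_fst : continuous (fun z : V * V => phi z.1).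
Proof.
move=> z.
by apply: (@continuous_comp _ _ _ fst phi); [exact: cvg_fst|exact: cphi].
Qed.

Lemma measurable_tilt : measurable_fun setT tilt.
Proof.
apply: continuous_measurable_rV2 => z; apply: cvgM; last exact: cvg_cst.
apply: cvgB; last exact: cvg_cst.
by apply: cvgB; [exact: cphi_shear|exact: cphi_fst].
Qed.

Lemma tilt_bounded : exists M : R, forall z, `|tilt z| <= M.
Proof.
have [M phiM] := periodic_bounded1 cphi pphi.
exists ((M + M + `|lambda|) / h) => z; rewrite normrM normfV (gtr0_norm h0).
rewrite ler_pM2r ?invr_gt0//.
rewrite (le_trans (ler_normB _ _))// lerD2r (le_trans (ler_normB _ _))//.
exact: lerD.
Qed.

Lemma L_lower_bound : exists B : R, forall z : V * V,
  norm1 z.2 <= L z.1 z.2 + B /\ `|L z.1 z.2| <= L z.1 z.2 + B.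
Proof.
have [b Lb] := superlinear_ge_norm1 ltr01 cL pL sL.
(* The factor 2 serves the second bound: [- L <= L + 2 |b|] amounts to [L >= - |b|]. *)
exists (2 * `|b|) => z; have := Lb z.1 z.2; rewrite mul1r => Lz.
have := ler_norm b; have := normr_ge0 b; have : 0 <= norm1 z.2 by exact: sumr_ge0.
split; first lra.
by rewrite ler_norml; apply/andP; split; lra.
Qed.

(** The kernel decays like [expR (- (L / eps))]. Half of this rate absorbs the factor [|L|]; the
    other half remains as exponential decay in [v], uniform in [x]. *)
Lemma L_gibbs_kernel_bound : exists C : R, 0 <= C /\ forall z : V * V,
  `|L z.1 z.2| * k z <= C * expR (- ((2 * eps)^-1 * norm1 z.2)).
Proof.
have [B LB] := L_lower_bound; have [M tM] := tilt_bounded.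
exists (2 * eps * expR ((B + M) / eps)); split.
  by rewrite mulr_ge0 ?expR_ge0// mulr_ge0// ltW.
move=> z; have [nL LL] := LB z; set s := L z.1 z.2 + B in nL LL.
have s0 : 0 <= s by rewrite (le_trans _ LL).
have kE : k z <= expR (- (s / eps)) * expR ((B + M) / eps).
  rewrite -expRD -ler_ln ?posrE ?expR_gt0// ln_gibbs_kernel expRK.
  have := tM z; rewrite ler_norml => /andP[tz _].
  rewrite -subr_ge0 (_ : _ - _ = (M + tilt z) / eps); last first.
    by rewrite /s; field; rewrite gt_eqF.
  by rewrite divr_ge0 ?(ltW eps0)//; lra.
(* [s expR (- s / eps) <= 2 eps expR (- s / (2 eps))] by [y <= expR y] at
   [y = s / (2 eps)]. *)
have sE : s <= 2 * eps * expR (s / (2 * eps)).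
  rewrite -ler_pdivrMl ?mulr_gt0// mulrC.
  by rewrite (le_trans _ (expR_ge1Dx _))// lerDr.
apply: (le_trans (ler_pM _ _ LL kE)); rewrite ?expR_ge0//.
apply: (@le_trans _ _ (2 * eps * expR (s / (2 * eps)) *
  (expR (- (s / eps)) * expR ((B + M) / eps)))).
  by rewrite ler_wpM2r// mulr_ge0 ?expR_ge0.
rewrite [leLHS](_ : _ = 2 * eps * expR ((B + M) / eps) *
    expR (- ((2 * eps)^-1 * s))); last first.
  rewrite -!mulrA; congr (_ * (_ * _)); rewrite -!expRD; congr expR.
  by field; rewrite gt_eqF.
rewrite ler_wpM2l ?mulr_ge0 ?expR_ge0 ?(ltW eps0)//.
by rewrite ler_expR lerN2 ler_pM2l// invr_gt0 mulr_gt0.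
Qed.

Local Open Scope ereal_scope.

Section density.
Variable g : V * V -> R.
Hypothesis hg : holonomic_density h g.

Let mg : measurable_fun setT g. Proof. by case: hg => P _ []. Qed.

Let g0 z : (0 <= g z)%R. Proof. by case: hg => P _ []. Qed.

Lemma integral_holonomic_density : \int[leb2]_(z in D) (g z)%:E = 1.
Proof. by case: hg => P [PD _] [_ _ _ PE]; rewrite -PD PE// setIid. Qed.

Lemma integrable_holonomic_density : leb2.-integrable D (EFin \o g).
Proof.
apply/integrableP; split; first exact/measurable_EFinP/measurable_funTS.
under eq_integral do rewrite gee0_abs ?lee_fin//.
by rewrite integral_holonomic_density ltry.
Qed.

Lemma integrable_bounded_density (f : V * V -> R) : measurable_fun setT f ->
  (exists M : R, forall z, `|f z| <= M)%R ->
  leb2.-integrable D (fun z => (f z * g z)%:E).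
Proof.
move=> mf [M fM]; have := integrableMr mD (measurable_funTS mf) _
  integrable_holonomic_density; apply.
exists M; split; first exact: num_real.
by move=> r rM z _ /=; rewrite (le_trans (fM z))// ltW.
Qed.

Lemma integral_tilt : \int[leb2]_(z in D) (tilt z * g z)%:E = (- (lambda / h))%:E.
Proof.
pose d (z : V * V) := (phi (z.1 + h *: z.2)%R - phi z.1)%R.
have md : measurable_fun setT d.
  by apply: measurable_funB; exact: continuous_measurable_rV2.
have dg0 : \int[leb2]_(z in D) (d z * g z)%:E = 0.
  case: hg => P [_ Phol] [_ _ _ PE].
  by rewrite -(integral_density mD mg g0 PE)// Phol.
have dgint : leb2.-integrable D (fun z => (d z * g z)%:E).
  apply: integrable_bounded_density => //.
  have [M phiM] := periodic_bounded1 cphi pphi; exists (M + M)%R => z.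
  by rewrite (le_trans (ler_normB _ _))// lerD.
transitivity (\int[leb2]_(z in D)
    ((h^-1)%:E * (d z * g z)%:E + (- (lambda / h))%:E * (g z)%:E)).
  apply: eq_integral => z _; rewrite -!EFinM -EFinD; congr EFin.
  by rewrite /tilt /d; field; rewrite gt_eqF.
rewrite integralD//; [|exact: integrableZl|
  by apply: integrableZl => //; exact: integrable_holonomic_density].
rewrite !integralZl//; last exact: integrable_holonomic_density.
by rewrite dg0 mule0 add0e integral_holonomic_density mule1.
Qed.

Let mL : measurable_fun setT (fun z : V * V => L z.1 z.2).
Proof. exact: continuous_measurable_rV2. Qed.

Let mLg : measurable_fun D (action_integrand L g).
Proof.
by apply/measurable_EFinP; apply: measurable_funTS; exact: measurable_funM.
Qed.

(** [L] is bounded below and [g] has mass 1, so the negative part has a finite integral and the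
    positive part alone decides. *)
Lemma integrable_action_or_pinfty :
  leb2.-integrable D (action_integrand L g) \/ action L g = +oo.
Proof.
have [B LB] := L_lower_bound.
have neg : \int[leb2]_(z in D) (action_integrand L g)^\- z < +oo.
  apply: (@le_lt_trans _ _ (\int[leb2]_(z in D) (B%:E * (g z)%:E))).
    apply: ge0_le_integral => //.
    - exact: measurable_funeneg.
    - by apply/measurable_EFinP; apply: measurable_funTS; exact: measurable_funM.
    - move=> z _; have [_ Lz] := LB z.
      rewrite funenegE /action_integrand -EFinN -EFin_max -EFinM lee_fin.
      have := Lz; rewrite ler_norml => /andP[L1 L2].
      by rewrite ge_max -mulNr ler_wpM2r ?mulr_ge0//; lra.
  rewrite integralZl//; last exact: integrable_holonomic_density.
  by rewrite integral_holonomic_density mule1 ltry.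
have [pos|] := ltP (\int[leb2]_(z in D) (action_integrand L g)^\+ z) +oo.
  left; apply/integrableP; split => //.
  under eq_integral do rewrite -/((abse \o _) _) fune_abse.
  rewrite ge0_integralD//; last 2 first.
  - exact: measurable_funepos.
  - exact: measurable_funeneg.
  exact: lte_add_pinfty.
rewrite leye_eq => /eqP pos; right; rewrite /action integralE pos.
by rewrite addye// eqe_oppLR/= lt_eqF.
Qed.

Let m := marginal g.
(** The marginal as an extended integral, to which Tonelli applies; [m] is its [fine] part, hence 0
    where [G] is [+oo]. *)
Let G x := \int[leb]_v (g (x, v))%:E.

Let mG : measurable_fun setT G.
Proof.
apply: (@measurable_integral_snd _ _ (EFin \o g)) => //.
exact/measurable_EFinP.
Qed.

Let G0 x : 0 <= G x.
Proof. by apply: integral_ge0 => v _; rewrite lee_fin. Qed.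

Let integral_G : \int[leb]_(x in @unit_cell R N) G x = 1.
Proof.
rewrite -integral_holonomic_density ge0_integral_phase_cell//.
exact/measurable_EFinP.
Qed.

Let mm : measurable_fun setT m.
Proof. by apply: measurableT_comp mG => //; exact: fine_measurable. Qed.

Let m0 x : (0 <= m x)%R.
Proof. by rewrite /m /marginal /Rintegral fine_ge0//; exact: G0. Qed.

Let mk : measurable_fun setT k.
Proof. by apply: continuous_measurable_rV2; exact: continuous_gibbs_kernel. Qed.

Let mmk : measurable_fun setT (fun z => (m z.1 * k z)%:E).
Proof.
by apply/measurable_EFinP; apply: measurable_funM => //; exact: measurableT_comp.
Qed.

(** Integrating out the kernel leaves [m], which is at most [G] even where [G] is infinite. The
    inequality has the direction that a lower bound of the entropy needs. *)
Lemma integral_marginal_gibbs_le1 : \int[leb2]_(z in D) (m z.1 * k z)%:E <= 1.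
Proof.
rewrite ge0_integral_phase_cell//; last first.
  by move=> z; rewrite lee_fin mulr_ge0 ?expR_ge0.
rewrite -integral_G; apply: ge0_le_integral => //.
- exact: measurable_unit_cell.
- by move=> x _; apply: integral_ge0 => v _; rewrite lee_fin mulr_ge0 ?expR_ge0.
- apply: measurable_funTS; apply: (measurable_integral_snd mmk) => z.
  by rewrite lee_fin mulr_ge0 ?expR_ge0.
- exact: measurable_funTS.
- move=> x _ /=; under eq_integral do rewrite EFinM.
  rewrite ge0_integralZl//=; last 3 first.
  + by apply/measurable_EFinP; exact: (measurableT_comp mk (pair1_measurable x)).
  + by move=> v _; rewrite lee_fin expR_ge0.
  + by rewrite lee_fin.
  rewrite integral_gibbs_kernel mule1 /m /marginal /Rintegral -/(G x).
  by case: (G x) (G0 x) => //= _; rewrite leey.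
Qed.

(* [m x = 0] also when the extended integral of [g (x, _)] is infinite, which
   happens for almost no [x]. *)
Lemma ae_marginal_eq0 :
  {ae leb2, forall z, D z -> (m z.1 = 0)%R -> (g z = 0)%R}.
Proof.
pose Z := m @^-1` [set 0%R].
have mZ : measurable Z by rewrite -[Z]setTI; exact: mm.
pose f (z : V * V) := (\1_Z z.1 * g z)%:E.
have mf : measurable_fun setT f.
  apply/measurable_EFinP; apply: measurable_funM => //.
  by apply: measurableT_comp => //; exact: measurable_indic.
have f0 z : 0 <= f z by rewrite lee_fin mulr_ge0.
have : \int[leb2]_(z in D) `|f z| = 0.
  under eq_integral do rewrite gee0_abs//.
  rewrite ge0_integral_phase_cell//.
  transitivity (\int[leb]_(x in @unit_cell R N) ((\1_Z x)%:E * G x)).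
    apply: eq_integral => x _; rewrite /f/=; under eq_integral do rewrite EFinM.
    rewrite ge0_integralZl//=; last by move=> v _; rewrite lee_fin.
    by apply/measurable_EFinP; exact: (measurableT_comp mg (pair1_measurable x)).
  have mcell := @measurable_unit_cell R N.
  rewrite (ae_eq_integral (cst 0))//; first exact: integral0.
    apply: measurable_funTS; apply: emeasurable_funM => //.
    by apply/measurable_EFinP; exact: measurable_indic.
  have : leb.-integrable (@unit_cell R N) G.
    apply/integrableP; split; first exact: measurable_funTS.
    under eq_integral do rewrite (gee0_abs (G0 _)).
    by rewrite integral_G ltry.
  move=> /(integrable_ae mcell); apply: filterS => x + cx => /(_ cx) Gx.
  rewrite indicE; case: (boolP (x \in Z)) => [|_]; last by rewrite mul0e.
  rewrite inE /Z/= /m /marginal /Rintegral -/(G x) => Gx0.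
  by rewrite -(fineK Gx) Gx0 mule0.
move=> /(ae_eq_integral_abs _ mD (measurable_funTS mf)).
apply: filterS => z + Dz mz => /(_ Dz).
by rewrite /f indicE mem_set// mul1r => -[].
Qed.

Lemma measurable_entropy_integrand : measurable_fun setT (entropy_integrand g).
Proof.
pose Z := m @^-1` [set 0%R].
have mZ : measurable Z by rewrite -[Z]setTI; exact: mm.
(* The logarithm of the quotient splits only where [g] and [m] are both positive. The indicator
   reproduces the value 0 that the conventions give where [m = 0]; where [g = 0] both sides
   vanish. *)
have -> : entropy_integrand g = EFin \o
    (fun z => g z * (ln (g z) - ln (m z.1)) * \1_(~` Z) z.1)%R.
  apply/funext => z; rewrite /entropy_integrand/= -/(m z.1); congr EFin.
  rewrite -mulrA; have [->|gz] := eqVneq (g z) 0%R; first by rewrite !mul0r.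
  congr (_ * _)%R; rewrite indicE.
  have [mz|mz] := eqVneq (m z.1) 0%R.
    by rewrite mz invr0 mulr0 ln0// memNset ?mulr0//= => /(_ mz).
  rewrite mem_set ?mulr1; last exact/eqP.
  by rewrite ln_div// posrE lt_neqAle eq_sym ?gz ?g0 ?mz ?m0.
have mln (f : V * V -> R) :
    measurable_fun setT f -> measurable_fun setT (fun z => ln (f z)).
  by move=> mf; exact: (measurableT_comp (@measurable_ln R) mf).
apply/measurable_EFinP; apply: measurable_funM.
  apply: measurable_funM => //; apply: measurable_funB; apply: mln => //.
  exact: measurableT_comp.
apply: measurableT_comp => //.
by apply: measurable_indic; exact: measurableC.
Qed.

(** Integrability of [L * g] is what makes each term of the minorant [H] integrable, so that its
    integral can be computed term by term. *)
Lemma entropy_ge : leb2.-integrable D (action_integrand L g) ->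
  (- eps^-1)%:E * action L g + (eps^-1 * (lambda / h))%:E <= entropy g.
Proof.
move=> Lgint.
have gint := integrable_holonomic_density.
have tgint : leb2.-integrable D (fun z => (tilt z * g z)%:E).
  apply: integrable_bounded_density; first exact: measurable_tilt.
  exact: tilt_bounded.
have mk0 z : 0 <= (m z.1 * k z)%:E by rewrite lee_fin mulr_ge0 ?expR_ge0.
have mkint : leb2.-integrable D (fun z => (m z.1 * k z)%:E).
  apply/integrableP; split; first exact: measurable_funTS.
  under eq_integral do rewrite gee0_abs//.
  exact: (le_lt_trans integral_marginal_gibbs_le1 (ltry 1)).
(* This is [g - m * k + g * ln k], with [ln k] expanded by [ln_gibbs_kernel]. *)
pose H (z : V * V) := ((g z)%:E - (m z.1 * k z)%:E) +
  ((- eps^-1)%:E * action_integrand L g z + (- eps^-1)%:E * (tilt z * g z)%:E).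
have int1 : leb2.-integrable D (fun z => (g z)%:E - (m z.1 * k z)%:E).
  exact: integrableB.
have int2 : leb2.-integrable D (fun z => (- eps^-1)%:E * action_integrand L g z +
    (- eps^-1)%:E * (tilt z * g z)%:E).
  by apply: integrableD => //; exact: integrableZl.
have Hint : leb2.-integrable D H by exact: integrableD.
apply: (@le_trans _ _ (\int[leb2]_(z in D) H z)).
  rewrite [leRHS]integralD// [X in _ <= X + _]integralB//.
  rewrite integralD//; [|exact: integrableZl|exact: integrableZl].
  rewrite !integralZl// integral_tilt integral_holonomic_density -EFinM mulrNN.
  rewrite leeDr// sube_ge0; first exact: integral_marginal_gibbs_le1.
  by rewrite orbT.
have mH := measurable_int _ Hint.
have mF := measurable_funTS (D := D) measurable_entropy_integrand.
have HF : {ae leb2, forall z, D z -> H z <= entropy_integrand g z}.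
  have := ae_marginal_eq0; apply: filterS => z + Dz => /(_ Dz) mg0.
  rewrite /H /entropy_integrand /action_integrand -!EFinM -!EFinD lee_fin.
  rewrite -/(m z.1).
  rewrite (_ : (_ + _)%R = g z - m z.1 * k z + g z * ln (k z))%R; last first.
    by rewrite ln_gibbs_kernel; ring.
  by apply: gibbs_inequality => //; exact: expR_gt0.
(* The entropy may be infinite, so positive and negative parts are compared separately, as integrals
   of nonnegative functions. *)
rewrite /entropy integralE [leRHS]integralE; apply: leeB.
  apply: ae_ge0_le_integral => //; [exact: measurable_funepos|
    exact: measurable_funepos|].
  apply: filterS HF => z HF Dz; have := HF Dz.
  by rewrite !funeposE ge_max le_max => ->/=; rewrite le_max lexx orbT.
apply: ae_ge0_le_integral => //; [exact: measurable_funeneg|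
  exact: measurable_funeneg|].
apply: filterS HF => z HF Dz; have := HF Dz.
by rewrite !funenegE ge_max le_max leeN2 => ->/=; rewrite le_max lexx orbT.
Qed.

Lemma penalized_action_ge : penalized_action_defined eps L g ->
  (lambda / h)%:E <= penalized_action eps L g.
Proof.
move=> /and3P[_ _ sum_defined]; rewrite /penalized_action.
have [Lgint|Loo] := integrable_action_or_pinfty; last first.
  (* With an infinite action, definedness of the sum forbids the entropy term to be [-oo], so the
     functional equals [+oo]. *)
  rewrite Loo addye ?leey//; move: sum_defined; rewrite Loo.
  by rewrite /adde_def/= andbT.
have /fineK aE := integrable_fin_num mD Lgint.
have := entropy_ge Lgint; rewrite -[action L g]aE -EFinM -EFinD.
rewrite -(lee_pmul2l (x := eps%:E)) ?lte_fin// => le_entropy.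
apply: le_trans (leeD2l _ le_entropy).
rewrite -EFinM -EFinD lee_fin le_eqVlt; apply/orP; left; apply/eqP.
by field; rewrite !gt_eqF.
Qed.

End density.

(** The kernel bound dominates the integrand by [theta x] times a function of [v], and Tonelli
    splits the double integral into two finite factors. *)
Lemma integrable_action_mu : leb2.-integrable D (action_integrand L mu).
Proof.
have [C [C0 Ck]] := L_gibbs_kernel_bound.
have mmu : measurable_fun setT mu by exact: measurable_mu.
have mL : measurable_fun setT (fun z : V * V => L z.1 z.2).
  exact: continuous_measurable_rV2.
pose c : R := ((2 * eps)^-1)%R.
have c0 : (0 < c)%R by rewrite invr_gt0 mulr_gt0.
pose e (v : V) := (C%:E * (expR (- (c * norm1 v)))%:E).
have me : measurable_fun setT e.
  by apply: emeasurable_funM => //; exact: measurable_expR_norm1.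
have e0 v : 0 <= e v by rewrite mule_ge0 ?lee_fin ?expR_ge0.
have mth : measurable_fun setT (fun z : V * V => (theta z.1)%:E).
  exact: (measurableT_comp measurable_theta measurable_fst).
have mte : measurable_fun setT (fun z : V * V => (theta z.1)%:E * e z.2).
  by apply: emeasurable_funM => //; exact: (measurableT_comp me measurable_snd).
apply/integrableP; split.
  by apply/measurable_EFinP; apply: measurable_funTS; exact: measurable_funM.
apply: (@le_lt_trans _ _ (\int[leb2]_(z in D) ((theta z.1)%:E * e z.2))).
  apply: ge0_le_integral => //.
  - apply: measurable_funTS; apply: measurableT_comp => //.
    by apply/measurable_EFinP; exact: measurable_funM.
  - exact: measurable_funTS.
  - move=> z _; rewrite /action_integrand /e -!EFinM lee_fin normrM.
    rewrite (ger0_norm (mu_ge0 _)).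
    by rewrite /mu_fun -/(k z) mulrCA ler_wpM2l ?expR_ge0.
have te0 (z : V * V) : 0 <= (theta z.1)%:E * e z.2.
  by apply: mule_ge0 => //; rewrite lee_fin expR_ge0.
rewrite (ge0_integral_phase_cell mte te0).
rewrite (eq_integral (fun x => (theta x)%:E * \int[leb]_v e v)); last first.
  by move=> x _; rewrite -ge0_integralZl//= lee_fin expR_ge0.
rewrite ge0_integralZr//=; last 4 first.
- exact: measurable_unit_cell.
- by apply: measurable_funTS; exact: measurable_theta.
- by move=> x _; rewrite lee_fin expR_ge0.
- exact: integral_ge0.
rewrite theta1 mul1e ge0_integralZl//=; last exact: measurable_expR_norm1.
by rewrite lte_mul_pinfty ?lee_fin// integral_expR_norm1_lty.
Qed.

(** [theta] never vanishes, so [mu / theta] is the kernel at every point. The identity also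
    transfers integrability from the action to the entropy. *)
Lemma entropy_integrand_mu z : entropy_integrand mu z =
  (- eps^-1)%:E * action_integrand L mu z + (- eps^-1)%:E * (tilt z * mu z)%:E.
Proof.
have mE : marginal mu z.1 = theta z.1.
  rewrite /marginal /Rintegral.
  under eq_integral => v _.
    rewrite (_ : mu (z.1, v) = theta z.1 * k (z.1, v))%R// EFinM; over.
  rewrite ge0_integralZl//=; last 3 first.
  - apply/measurable_EFinP.
    apply: (measurableT_comp _ (pair1_measurable z.1)).
    by apply: continuous_measurable_rV2; exact: continuous_gibbs_kernel.
  - by move=> v _; rewrite lee_fin expR_ge0.
  - by rewrite lee_fin expR_ge0.
  by rewrite integral_gibbs_kernel// mule1.
rewrite /entropy_integrand mE (_ : mu z / theta z.1 = k z)%R; last first.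
  by rewrite /mu_fun -/(k z) mulrC mulKf// gt_eqF// expR_gt0.
by rewrite ln_gibbs_kernel /action_integrand -!EFinM -EFinD; congr EFin; ring.
Qed.

Lemma penalized_action_mu :
  penalized_action_defined eps L mu /\
  penalized_action eps L mu = (lambda / h)%:E.
Proof.
have hmu : holonomic_density h mu by exact: mu_holonomic_density.
have Lint := integrable_action_mu.
have tint : leb2.-integrable D (fun z => (tilt z * mu z)%:E).
  by apply: integrable_bounded_density => //;
    [exact: measurable_tilt|exact: tilt_bounded].
have eE : entropy_integrand mu = fun z => (- eps^-1)%:E * action_integrand L mu z
    + (- eps^-1)%:E * (tilt z * mu z)%:E.
  by apply/funext => z; exact: entropy_integrand_mu.
have eint : leb2.-integrable D (entropy_integrand mu).
  by rewrite eE; apply: integrableD => //; exact: integrableZl.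
have defined f : leb2.-integrable D f -> integral_defined leb2 D f.
  move=> fint; apply: fin_num_adde_defr.
  exact: (integrable_pos_fin_num mD fint).
have aF := integrable_fin_num mD Lint.
split.
  rewrite /penalized_action_defined !defined//=.
  exact: fin_num_adde_defr.
rewrite /penalized_action /entropy eE integralD//; [|exact: integrableZl|
  exact: integrableZl].
rewrite !integralZl// integral_tilt// -/(action L mu) -[action L mu](fineK aF).
move: (fine _) => a.
transitivity (a + eps * (- eps^-1 * a + - eps^-1 * - (lambda / h)))%:E%R => //.
by congr EFin; field; rewrite !gt_eqF.
Qed.

Lemma mu_minimizes : minimizes_penalized_action eps L (holonomic_density h) mu.
Proof.
have [mu_defined mu_value] := penalized_action_mu.
split; [exact: mu_holonomic_density|exact: mu_defined|].
by move=> g hg gdef; rewrite mu_value; exact: penalized_action_ge.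
Qed.

End optimality.

End gibbs_minimizer.

Lemma lipschitz_continuous (R : realType) (V : normedModType R) (f : V -> R) :
  lipschitz f -> continuous f.
Proof.
move=> /pinfty_ex_gt0[k k0 fk] x; apply/cvgrPdist_le => e e0.
apply/nbhs_ballP; exists (e / k); first exact: divr_gt0.
move=> y; rewrite -ball_normE/= => xy.
apply: (le_trans (fk (x, y) (conj Logic.I Logic.I))).
by rewrite /= mulrC -ler_pdivlMr// ltW.
Qed.

Theorem theorem2 (R : realType) (N : nat) (L : 'rV[R]_N -> 'rV[R]_N -> R)
    (L_C2 : class_C 2 (fun z : 'rV[R]_N * 'rV[R]_N => L z.1 z.2))
    (L_periodic : forall v, Zperiodic (L ^~ v))
    (L_superlinear : superlinear L)
    (L_convex : forall x v, positive_definite (hessian_v L x v))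
    (L_semiconcave : exists C Gamma : R, [/\ 0 < C, 0 < Gamma &
      forall x y v z : 'rV[R]_N,
        L (x + y) (v - z) + L (x - y) (v + z) - 2 * L x v
          <= C * enorm y ^+ 2 + Gamma * enorm z ^+ 2])
    (lambda : R -> R -> R) (phi phibar : R -> R -> 'rV[R]_N -> R)
    (phi_periodic : forall eps h : R, 0 < eps -> 0 < h ->
      Zperiodic (phi eps h) /\ Zperiodic (phibar eps h))
    (phi_lipschitz : forall eps h : R, 0 < eps -> 0 < h ->
      lipschitz (phi eps h) /\ lipschitz (phibar eps h))
    (phi_eq : forall eps h : R, 0 < eps -> 0 < h ->
      forall x, op_G eps h L (phi eps h) x = phi eps h x + lambda eps h)
    (phibar_eq : forall eps h : R, 0 < eps -> 0 < h ->
      forall x, op_Gbar eps h L (phibar eps h) x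
                = phibar eps h x + lambda eps h)
    (phi_semiconcave : exists sigma h0 : R, 0 < h0 /\
      forall eps h : R, 0 < eps -> 0 < h -> h <= h0 ->
        semiconcave sigma (phi eps h) /\ semiconcave sigma (phibar eps h))
    (phi_bounded : exists B h1 : R, 0 < h1 /\
      forall eps h : R, 0 < eps -> 0 < h -> h <= h1 ->
        forall x, `|phi eps h x| <= B /\ `|phibar eps h x| <= B)
    (theta_normalized : forall eps h : R, 0 < eps -> 0 < h ->
      (\int[lebesgue_rV R N]_(x in @unit_cell R N)
         (theta_fun eps h (phi eps h) (phibar eps h) x)%:E = 1)%E) :
  forall eps h : R, 0 < eps -> 0 < h ->
    minimizes_penalized_action eps L (@holonomic_density R N h)
      (mu_fun eps h L (lambda eps h) (phi eps h) (phibar eps h)).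
Proof.
move=> eps h eps0 h0.
have [pphi pphibar] := phi_periodic _ _ eps0 h0.
have [/lipschitz_continuous cphi /lipschitz_continuous cphibar] :=
  phi_lipschitz _ _ eps0 h0.
apply: mu_minimizes => //; [exact: L_C2.1|exact: phi_eq|exact: phibar_eq|].
exact: theta_normalized.
Qed.
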